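(* Let $J:\mathbb{R}^n\to[0,\infty)$ be convex, lower semicontinuous and absolutely one-homogeneous, and let $f\in\mathbb{R}^n$. The function $u_{IS}:(0,\infty)\to\mathbb{R}^n$ is bounded almost everywhere, and $p_{IS}:[t_0,\infty)\to\mathbb{R}^n$ is Lipschitz continuous for every $t_0>0$. Moreover, the spectral representation satisfies $\phi_{IS}\in\big(W^{1,1}_{loc}([0,\infty);\mathbb{R}^n)\big)^*$, i.e. $\phi_{IS}$ is a well-defined continuous linear functional on $W^{1,1}_{loc}([0,\infty);\mathbb{R}^n)$.
   Context: Absolutely one-homogeneous means $J(su)=|s|J(u)$ for all $s\in\mathbb{R}$, $u\in\mathbb{R}^n$. $P_0$ is the orthogonal projection onto the linear subspace $\mathcal{N}(J)=\{u:J(u)=0\}$. The inverse scale space flow is: $q_{IS}:[0,\infty)\to\mathbb{R}^n$ locally absolutely continuous and $v_{IS}$ measurable with $\partial_s q_{IS}(s)=f-v_{IS}(s)$, $q_{IS}(s)\in\partial J(v_{IS}(s))$ for a.e. $s>0$, $q_{IS}(0)=0$, where $\partial J$ is the convex subdifferential. Put $u_{IS}(t)=v_{IS}(1/t)$ and $p_{IS}(t)=q_{IS}(1/t)$ for $t>0$. There is $T<\infty$ with $u_{IS}(t)=P_0(f)$ for a.e. $t\ge T$. The frequency representation is $\tilde\phi_{IS}(s)=\partial_s v_{IS}(s)$, and the wavelength representation $\phi_{IS}$ is obtained from it by the change of variables $t=1/s$, i.e. $\int_0^\infty w(t)\cdot\phi_{IS}(t)\,dt=\int_0^\infty w(1/s)\cdot\tilde\phi_{IS}(s)\,ds$,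 so that formally $\phi_{IS}=-\partial_t u_{IS}$; it is understood, after integration by parts, as the functional $$ w\mapsto w(0)\cdot f-w(T)\cdot P_0(f)+\int_0^T \partial_t w(t)\cdot u_{IS}(t)\,dt . $$ $W^{1,1}_{loc}([0,\infty);\mathbb{R}^n)$ is the space of functions belonging to $W^{1,1}((0,T');\mathbb{R}^n)$ for every $T'<\infty$, with the topology given by these seminorms. *)

(* Defs.v *)
From HB Require Import structures.
From mathcomp Require Import all_boot all_order all_algebra.
From mathcomp Require Import all_classical all_reals all_analysis.
Import Order.TTheory GRing.Theory Num.Theory.
Import numFieldNormedType.Exports.

Set Implicit Arguments.
Unset Strict Implicit.
Unset Printing Implicit Defensive.

Local Open Scope classical_set_scope.
Local Open Scope ring_scope.

(* R^n is ['rV[R]_n].  Its library norm is the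
   maximum norm; boundedness, Lipschitz continuity, absolute continuity and the
   W^{1,1} topology do not depend on the choice of norm.  Orthogonality and the
   pairings of vectors use the Euclidean inner product [dot]. *)

Section Convexity.
Context {R : realType} {n : nat}.
Notation E := ('rV[R]_n).

Definition dot (x y : E) : R := \sum_(i < n) x ord0 i * y ord0 i.

Definition nullspace (J : E -> R) : set E := [set x | J x = 0].

(* The point z of V with x - z orthogonal to V (unique when V is a linear
   subspace). *)
Definition orth_proj (V : set E) (x : E) : E :=
  xget 0 [set z | V z /\ forall y, V y -> dot (x - z) y = 0].

Definition subdifferential (J : E -> R) (x : E) : set E :=
  [set p | forall y, J x + dot p (y - x) <= J y].

Definition abs_homogeneous1 (J : E -> R) : Prop :=
  forall (s : R) (x : E), J (s *: x) = `|s| * J x.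

End Convexity.

Section Flow.
Context {R : realType} {n : nat}.
Notation E := ('rV[R]_n).
Notation mu := (@lebesgue_measure R).

Definition abs_continuous_on (a b : R) (q : R -> E) : Prop :=
  forall e : R, 0 < e -> exists2 d : R, 0 < d &
    forall (m : nat) (x y : 'I_m -> R),
      (forall i, [/\ a <= x i, x i <= y i & y i <= b]) ->
      trivIset setT (fun i => `]x i, y i[%classic) ->
      \sum_(i < m) (y i - x i) < d ->
      \sum_(i < m) `|q (y i) - q (x i)| < e.

Definition measurable_on (D : set R) (w : R -> E) : Prop :=
  forall i, measurable_fun D (fun t => w t ord0 i).

(* Functions on [0, +oo[ or ]0, +oo[ are total functions on R whose other
   values are irrelevant. *)
Definition inverse_scale_space_flow (J : E -> R) (f : E) (q v : R -> E) : Prop :=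
  [/\ forall b : R, 0 < b -> abs_continuous_on 0 b q,
      measurable_on `]0, +oo[%classic v,
      {ae mu, forall s : R, 0 < s -> is_derive s 1 q (f - v s)},
      {ae mu, forall s : R, 0 < s -> subdifferential J (v s) (q s)} &
      q 0 = 0].

Definition u_IS (v : R -> E) (t : R) : E := v t^-1.
Definition p_IS (q : R -> E) (t : R) : E := q t^-1.

Definition extinction_time (J : E -> R) (f : E) (v : R -> E) (T : R) : Prop :=
  0 <= T /\
  {ae mu, forall t : R, T <= t -> u_IS v t = orth_proj (nullspace J) f}.

End Flow.

Section Sobolev.
Context {R : realType} {n : nat}.
Notation E := ('rV[R]_n).
Notation mu := (@lebesgue_measure R).

Definition L1 (T : R) (w : R -> E) : Prop :=
  forall i, mu.-integrable `]0, T[ (fun t => (w t ord0 i)%:E).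

Definition test_function (T : R) (phi : R -> R) : Prop :=
  [/\ forall x, derivable phi x 1,
      continuous (derive1 phi) &
      exists a b : R, [/\ 0 < a, b < T &
        forall x, x \notin `[a, b] -> phi x = 0]].

(* g in L^1(0,T) is a weak derivative of w on ]0, T[; as usual on an interval
   (e.g. Brezis, Functional Analysis, Section 8.2) test functions are C^1 with
   compact support. *)
Definition weak_derivative (T : R) (w g : R -> E) : Prop :=
  L1 T g /\
  forall phi, test_function T phi -> forall i,
    \int[mu]_(t in `]0, T[) (w t ord0 i * derive1 phi t) =
    - \int[mu]_(t in `]0, T[) (g t ord0 i * phi t).

Definition W11 (T : R) (w : R -> E) : Prop :=
  L1 T w /\ exists g, weak_derivative T w g.

(* W^{1,1}_loc([0,oo)).  Its elements are functions; two of them stand for the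
   same element when they agree a.e. on ]0, +oo[. *)
Definition W11loc (w : R -> E) : Prop := forall T : R, 0 < T -> W11 T w.

(* [wderiv T w] is the weak derivative of w on ]0, T[, determined up to a null
   set. *)
Definition wderiv (T : R) (w : R -> E) : R -> E :=
  xget (fun=> 0) [set g | weak_derivative T w g].

Definition W11_seminorm (T : R) (w : R -> E) : R :=
  \int[mu]_(t in `]0, T[) `|w t| + \int[mu]_(t in `]0, T[) `|wderiv T w t|.

(* Neighborhoods of w0 in the topology given by the seminorms W11_seminorm T,
   T > 0.  These increase with T, so the balls of single seminorms form a base
   of neighborhoods. *)
Definition W11loc_nbhs (w0 : R -> E) : set_system (R -> E) :=
  filter_from [set Td : R * R | 0 < Td.1 /\ 0 < Td.2]
    (fun Td => [set w | W11loc w /\ W11_seminorm Td.1 (w - w0) < Td.2]).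

(* c is the representative of w that is continuous up to t = 0; point values
   of elements of W^{1,1}_loc are those of c. *)
Definition continuous_rep (w c : R -> E) : Prop :=
  {within `[0, +oo[, continuous c} /\
  {ae mu, forall t : R, 0 < t -> w t = c t}.

Definition crep (w : R -> E) : R -> E :=
  xget (fun=> 0) [set c | continuous_rep w c].

End Sobolev.

Section SpectralRepresentation.
Context {R : realType} {n : nat}.
Notation E := ('rV[R]_n).
Notation mu := (@lebesgue_measure R).

(* w(0).f - w(T).P_0(f) + \int_0^T w'(t).u_IS(t) dt, where c provides the point
   values of w, and g its weak derivative. *)
Definition phi_IS_formula (J : E -> R) (f : E) (v : R -> E) (T : R)
    (c g : R -> E) : R :=
  dot (c 0) f - dot (c T) (orth_proj (nullspace J) f)
  + \int[mu]_(t in `]0, T[) dot (g t) (u_IS v t).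

Definition phi_IS (J : E -> R) (f : E) (v : R -> E) (T : R) (w : R -> E) : R :=
  phi_IS_formula J f v T (crep w) (wderiv T w).

(* The expression for phi_IS makes sense on all of W^{1,1}_loc: point values
   exist, the integral converges, and the result depends neither on the choices
   of continuous representative and weak derivative (hence not on the
   representative w either) nor on the extinction time. *)
Definition phi_IS_well_defined (J : E -> R) (f : E) (v : R -> E) (T : R)
    : Prop :=
  forall w, W11loc w ->
    [/\ exists c, continuous_rep w c,
        exists g, weak_derivative T w g,
        forall c g, continuous_rep w c -> weak_derivative T w g ->
          mu.-integrable `]0, T[ (fun t => (dot (g t) (u_IS v t))%:E) /\
          phi_IS J f v T w = phi_IS_formula J f v T c g &
        forall T', extinction_time J f v T' ->
          phi_IS J f v T' w = phi_IS J f v T w].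

Definition W11loc_linear (Phi : (R -> E) -> R) : Prop :=
  forall (a : R) (w1 w2 : R -> E), W11loc w1 -> W11loc w2 ->
    Phi (a *: w1 + w2) = a * Phi w1 + Phi w2.

Definition W11loc_continuous (Phi : (R -> E) -> R) : Prop :=
  forall w0, W11loc w0 -> Phi w @[w --> W11loc_nbhs w0] --> Phi w0.

End SpectralRepresentation.

(* Main.v *)
Require Import Defs.
From HB Require Import structures.
From mathcomp Require Import all_boot all_order all_algebra.
From mathcomp Require Import all_classical all_reals all_analysis.
From mathcomp Require Import measurable_realfun.
From mathcomp Require Import ring lra.
Import Order.TTheory GRing.Theory Num.Theory.
Import numFieldNormedType.Exports.

(** The flow is governed by one identity.  Since [J] is one-homogeneous,
    [q(s)] in the subdifferential of [J] at [v(s)] means that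
    [q(s).v(s) = J(v(s))] and that [q(s)] lies in the polar set
    [K = {p | p.y <= J(y) for all y}] ([subdifferential_polar]).  By continuity of
    [q] and closedness of [K] the whole curve stays in [K] ([flow_polar]).  Hence
    [r |-> q(r).v(s)] is maximal at [r = s], and differentiating there gives
    [(f - v(s)).v(s) = 0] ([flow_velocity_orthogonal]), so that
    [|v|^2 = f.v <= |f||v|] in the Euclidean norm: [v] is bounded.  Then [q] is an
    absolutely continuous curve with bounded speed, therefore Lipschitz
    ([abs_continuous_increment_le]), and composing with [t |-> 1/t], which is
    Lipschitz on [t0, oo[ and preserves null sets ([ae_inv]), yields the claims
    on [u_IS] and [p_IS].

    The extinction time comes from [q(0) = 0].  The set [K] is symmetric and
    convex, so it is a neighbourhood of the origin in its own span, and
    [2 q(s)] is still in [K] for small [s] ([polar_double]).  Then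
    [2 J(v(s)) = 2 q(s).v(s) <= J(v(s))], i.e. [J(v(s)) = 0]; and [f - v(s)] is
    orthogonal to the null space of [J] because [q] is.  So [v(s)] is the
    projection of [f] for small [s], that is, for large [t = 1/s].

    For the functional one needs the one-dimensional Sobolev theory: an element
    [w] of [W^{1,1}(0,T)] with weak derivative [g] satisfies
    [w(y) - w(x) = \int_x^y g] for almost all [x < y].  It is obtained by
    testing with a C^1 function climbing from 0 to 1 near [x] and descending back
    near [y]; when the two transition zones shrink, its derivative picks out the
    values of [w] at the two points, provided they are Lebesgue points
    ([lebesgue_pt_increment]).  It follows that [w] has a continuous
    representative [c] ([continuous_rep_exists]), that [g] is unique almost
    everywhere ([weak_derivative_unique]) and that the values of [c] are
    controlled by the [W^{1,1}] norm ([continuous_rep_bound]).  As [u_IS] is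
    bounded, the expression defining [phi_IS] is a well defined linear functional
    bounded by a seminorm ([phi_IS_le_seminorm]), hence continuous; enlarging the
    extinction time does not change it because [u_IS] equals the projection on the
    added interval, where the integral of [w'] compensates the change of [w(T)]
    ([phi_IS_extinction_le]). *)

Set Implicit Arguments.
Unset Strict Implicit.
Unset Printing Implicit Defensive.

Local Open Scope classical_set_scope.
Local Open Scope ring_scope.

(** * Absolutely continuous curves *)

Section AbsolutelyContinuous.
Context {R : realType} {n : nat}.
Notation E := ('rV[R]_n).
Notation mu := (@lebesgue_measure R).

Lemma is_derive_expansion (q : R -> E) (s : R) (d : E) :
  is_derive s 1 q d -> forall e : R, 0 < e -> exists2 r : R, 0 < r &
    forall t, `|t - s| < r -> `|q t - q s - (t - s) *: d| <= e * `|t - s|.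
Proof.
move=> [qs qd] e e0.
have /cvgrPdist_le/(_ e e0) : h^-1 *: (q (h *: 1 + s) - q s) @[h --> 0^'] --> d.
  by rewrite -qd; exact: qs.
case=> r /= r0 H; exists r => // t tsr.
have [->|ts] := eqVneq t s; first by rewrite !subrr scale0r subrr !normr0 mulr0.
have ts0 : t - s != 0 by rewrite subr_eq0.
have := H (t - s); rewrite /ball_/= sub0r normrN => /(_ tsr ts0).
rewrite -[_ *: 1]/(_ * 1) mulr1 subrK => H1.
rewrite -[q t - q s](scalerKV ts0) -scalerBr normrZ mulrC.
by apply: ler_wpM2r => //; rewrite distrC.
Qed.

(** Continuous induction: a property that passes across every point, from
    somewhere slightly to its left to anywhere slightly to its right, holds up to
    the supremum of the points reached, hence at the right end. *)
Lemma real_induction (P : R -> Prop) (a b : R) : a <= b -> P a ->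
  (forall x, a <= x <= b -> exists2 r, 0 < r & forall z y,
    a <= z -> x - r < z -> z <= x -> x <= y -> y < x + r -> y <= b ->
    P z -> P y) -> P b.
Proof.
move=> ab Pa step.
pose S := [set z | a <= z <= b /\ P z].
have Sa : S a by split => //; rewrite lexx.
have hS : has_sup S by split; [exists a|exists b => z [/andP[]]].
have aS : a <= sup S by apply: ub_le_sup => //; case: hS.
have Sb : sup S <= b by apply: ge_sup; [exists a|move=> z [/andP[]]].
have /andP/step[r r0 H] := conj aS Sb.
have [z [/andP[az zb] Pz] Sz] := sup_adherent r0 hS.
have zS : z <= sup S by apply: ub_le_sup; [case: hS|split => //; rewrite az].
have [bS|Slb] := leP b (sup S).
  apply: (H z) => //; apply: le_lt_trans bS _; by rewrite ltrDl.
pose y := Num.min b (sup S + r / 2).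
have Sy : sup S < y by rewrite lt_min Slb ltrDl divr_gt0.
have yb : y <= b by rewrite ge_min lexx.
have yr : y < sup S + r.
  by rewrite gt_min (@ltrD2l R) ltr_pdivrMr// ltr_pMr// ltr1n orbT.
have Py : P y by apply: (H z) => //; exact: ltW.
have : y <= sup S.
  apply: ub_le_sup; first by case: hS.
  by split=> //; rewrite yb (le_trans aS (ltW Sy)).
by rewrite leNgt Sy.
Qed.

Lemma negligible_open_cover (N : set R) (e : R) : 0 < e -> mu.-negligible N ->
  exists U, [/\ open U, N `<=` U & (mu U <= e%:E)%E].
Proof.
move=> e0 /negligible_outer_measure N0.
have [U [oU NU]] := outer_measure_open_le N e0.
by rewrite N0 add0e => mUe; exists U.
Qed.

Lemma abs_continuous_onS (a a' b b' : R) (q : R -> E) : a <= a' -> b' <= b ->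
  abs_continuous_on a b q -> abs_continuous_on a' b' q.
Proof.
move=> aa' bb' qab e /qab[d d0 H]; exists d => // m x y xy.
apply: H => i; have [a'x ? yb'] := xy i.
by split => //; [exact: le_trans aa' _|exact: le_trans bb'].
Qed.

(** A mean value inequality.  The points without a derivative bounded by [M] lie
    in an open set [U] of small measure.  Sweeping [a, b] by continuous
    induction, a step across a point outside [U] costs at most [(M + e1)] times its
    length, while the steps across points of [U] are collected as disjoint intervals
    of small total length, over which the variation of [q] is small by absolute
    continuity. *)
Lemma abs_continuous_increment_le (a b M : R) (q : R -> E) : a <= b -> 0 <= M ->
  abs_continuous_on a b q ->
  {ae mu, forall s, a < s -> exists2 d : E, `|d| <= M & is_derive s 1 q d} ->
  `|q b - q a| <= M * (b - a).
Proof.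
move=> ab M0 acq [N [mN N0 goodN]].
apply/ler_addgt0Pr => e e0.
have e20 : 0 < e / 2 by rewrite divr_gt0.
have ba1 : 0 < b - a + 1 by rewrite ltr_wpDl// subr_ge0.
pose e1 := e / 2 / (b - a + 1).
have e10 : 0 < e1 by rewrite divr_gt0.
have [d d0 H] := acq _ e20.
(* The left end is put into U: the derivative is only controlled to its right. *)
have [U [oU NU mUd]] : exists U, [/\ open U, N `|` [set a] `<=` U
    & (mu U <= (d / 2)%:E)%E].
  apply: negligible_open_cover; first by rewrite divr_gt0.
  apply: negligibleU; first exact/negligibleP.
  by apply/negligibleP => //; exact: lebesgue_measure_set1.
(* X i and Y i are the ends of the intervals recorded so far.  Their total
   length is compared with the measure of the part of U on the left of z, so that
   an interval added beyond z increases both by its length. *)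
pose P z := exists m (X Y : nat -> R),
  [/\ forall i, (i < m)%N -> [/\ a <= X i, X i <= Y i & Y i <= z],
      forall i j, (i < j)%N -> (j < m)%N -> Y i <= X j,
      ((\sum_(i < m) (Y i - X i))%:E <= mu (U `&` `]-oo, z]))%E &
      `|q z - q a| <= (M + e1) * (z - a) + \sum_(i < m) `|q (Y i) - q (X i)|].
have : P b.
  apply: (@real_induction P a b) => //.
    exists 0, (fun=> a), (fun=> a); split => //; first by rewrite big_ord0.
    by rewrite !subrr normr0 mulr0 add0r big_ord0.
  move=> x /andP[ax xb].
  have [Ux|Ux] := pselect (U x).
    (* Near a point of U the whole step from z to y lies in U and is recorded. *)
    have /nbhs_ballP[r r0 xrU] : nbhs x U by exact: open_nbhs_nbhs.
    exists r => // z y az xrz zx xy yxr yb [m [X [Y [XY YX lenXY qz]]]].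
    have zy := le_trans zx xy.
    exists m.+1, (fun i => if i == m then z else X i),
      (fun i => if i == m then y else Y i); split.
    - move=> i; rewrite ltnS leq_eqVlt.
      case: eqVneq => //= _ /XY[? ? ?]; split=> //.
      exact: le_trans zy.
    - move=> i j ij; rewrite ltnS leq_eqVlt.
      case: (eqVneq j m) => /= [jm _|jm jm'].
        by rewrite ltn_eqF -?jm//; have [] := XY i; rewrite -?jm.
      by rewrite ltn_eqF ?(ltn_trans ij)//; exact: YX.
    - rewrite big_ord_recr/= eqxx (eq_bigr (fun i : 'I_m => Y i - X i)); last first.
        by move=> i _; rewrite ltn_eqF.
      rewrite EFinD.
      have -> : U `&` `]-oo, y] = (U `&` `]-oo, z]) `|` `]z, y].
        apply/seteqP; split => t /=; rewrite !in_itv/=.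
          by move=> [Ut ty]; have [tz|tz] := leP t z; [left|right].
        move=> [[Ut tz]|/andP[zt ty]]; first by split => //; exact: le_trans zy.
        split=> //; apply: xrU; rewrite /ball/= ltr_distlC.
        by rewrite (lt_trans xrz)//= (le_lt_trans ty).
      rewrite measureU//=; last 2 first.
      + by apply: measurableI => //; exact: open_measurable.
      + apply/seteqP; split => // t/= [[_]]; rewrite !in_itv/= => tz.
        by move=> /andP[]; rewrite ltNge tz.
      rewrite leeD// lebesgue_measure_itv/= lte_fin.
      by have [->|//] := eqVneq z y; [rewrite subrr ltxx|rewrite lt_neqAle zy => ->].
    - rewrite big_ord_recr/= eqxx (eq_bigr (fun i : 'I_m => `|q (Y i) - q (X i)|)); last first.
        by move=> i _; rewrite ltn_eqF.
      have : (M + e1) * (z - a) <= (M + e1) * (y - a).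
        by rewrite ler_wpM2l ?lerD2r// addr_ge0 ?(ltW e10).
      have : `|q y - q a| <= `|q y - q z| + `|q z - q a|.
        by rewrite -[X in `|X| <= _](subrKA (q z)) ler_normD.
      by move: qz; set A := \sum_(_ < _) _; lra.
  have gx : exists2 d : E, `|d| <= M & is_derive x 1 q d.
    have {}ax : a < x.
      by rewrite lt_neqAle ax andbT; apply/eqP => xa; apply: Ux; apply: NU; right.
    apply: contrapT => gx; apply: Ux; apply: NU; left; apply: goodN => /=.
    by move/(_ ax).
  have [D DM qD] := gx.
  have [r r0 qr] := is_derive_expansion qD e10.
  have qr1 t : `|t - x| < r -> `|q t - q x| <= (M + e1) * `|t - x|.
    move=> txr; rewrite -(subrK ((t - x) *: D) (q t - q x)).
    rewrite (le_trans (ler_normD _ _))// addrC mulrDl lerD ?qr//.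
    by rewrite normrZ mulrC ler_wpM2r.
  exists r => // z y az xrz zx xy yxr yb [m [X [Y [XY YX lenXY qz]]]].
  have zy := le_trans zx xy.
  exists m, X, Y; split => //.
  - by move=> i /XY[? ? ?]; split=> //; exact: le_trans zy.
  - apply: (le_trans lenXY); apply: le_measure; rewrite ?inE.
    + by apply: measurableI => //; exact: open_measurable.
    + by apply: measurableI => //; exact: open_measurable.
    + apply: setIS => t/=; rewrite !in_itv/= => tz; exact: le_trans zy.
  - have : `|q y - q a| <= `|q y - q z| + `|q z - q a|.
      by rewrite -[X in `|X| <= _](subrKA (q z)) ler_normD.
    have : `|q y - q z| <= (M + e1) * (y - z).
      rewrite -[X in `|X| <= _](subrKA (q x)) (le_trans (ler_normD _ _))//.
      rewrite -(subrKA x y (- z)) mulrDr; apply: lerD.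
        by rewrite (le_trans (qr1 _ _))// ger0_norm ?subr_ge0// ltrBlDl.
      rewrite distrC (le_trans (qr1 _ _))//.
        by rewrite distrC ger0_norm ?subr_ge0// ltrBlDl -ltrBlDr.
      by rewrite distrC ger0_norm ?subr_ge0.
    by move: qz; set A := \sum_(_ < _) _; lra.
move=> [m [X [Y [XY YX lenXY qb]]]].
apply: (le_trans qb).
have : \sum_(i < m) `|q (Y i) - q (X i)| < e / 2.
  apply: (H m (fun i => X i) (fun i => Y i)) => [i||].
  - exact: XY (ltn_ord i).
  - apply/trivIsetP => i j _ _.
    wlog ij : i j / (i < j)%N.
      move=> W ij; have := ij; rewrite neq_ltn => /orP[|] ?; first exact: W.
      by rewrite setIC; apply: W => //; rewrite eq_sym.
    move=> _; apply/seteqP; split => // t/= []; rewrite !in_itv/=.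
    move=> /andP[_ tY] /andP[Xt _]; have := lt_trans Xt tY.
    by rewrite ltNge YX ?ltn_ord.
  - apply: (@le_lt_trans _ _ (d / 2)); last by rewrite ltr_pdivrMr// ltr_pMr// ltr1n.
    rewrite -lee_fin (le_trans lenXY)// (le_trans _ mUd)// le_measure ?inE//.
    + by apply: measurableI => //; exact: open_measurable.
    + exact: open_measurable.
have : e1 * (b - a) <= e / 2.
  rewrite /e1 -mulrA ger_pMr// mulrC ler_pdivrMr// mul1r lerDl.
  exact: ler01.
by set A := \sum_(_ < _) _; lra.
Qed.
End AbsolutelyContinuous.

(** * Null sets of the line *)

Section NullSets.
Context {R : realType}.
Notation mu := (@lebesgue_measure R).
Implicit Types (N : set R).

(** A cover of [N] by intervals of small total length is turned into a cover of
    the image: the part of [N] in an interval of length [l] has its image in an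
    interval of length [2 L l] around any of its points. *)
Lemma lipschitz_image_negligible (phi : R -> R) (L : R) N : 0 <= L ->
  (forall x y, N x -> N y -> `|phi x - phi y| <= L * `|x - y|) ->
  mu.-negligible N -> mu.-negligible (phi @` N).
Proof.
move=> L0 lip N0; apply/negligible_outer_measure; apply/eqP.
rewrite eq_le outer_measure_ge0 andbT; apply/lee_addgt0Pr => e e0; rewrite add0e.
(* The summand 1 only makes the constant positive. *)
pose C := 2 * L + 1.
have C0 : 0 < C by rewrite ltr_wpDl// mulr_ge0.
have /negligible_outer_measure := N0; rewrite outer_measure_open_itv_cover => infN.
have /lb_ereal_inf_adherent : ereal_inf
    [set (\sum_(k <oo) wlength idfun (F k))%E | F in open_itv_cover N] \is a fin_num.
  by rewrite infN.
move=> /(_ (e / C)); rewrite divr_gt0// => /(_ isT)[_ [F [Fitv NF] <-]].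
rewrite infN add0e => Fe.
have cover k : exists I : set R, [/\ measurable I, phi @` (N `&` F k) `<=` I &
    (mu I <= C%:E * wlength idfun (F k))%E].
  have [[a b] /= Fab] := Fitv k.
  have [[x [Nx Fx]]|NF0] := pselect (N `&` F k !=set0); last first.
    exists set0; split => //; last first.
      by rewrite measure0 mule_ge0 ?lee_fin ?(ltW C0)// wlength_ge0.
    by move=> ? [x NFx ?]; case: NF0; exists x.
  have ab : a < b by move: Fx; rewrite Fab/= in_itv/= => /andP[]; exact: lt_trans.
  exists `[phi x - L * (b - a), phi x + L * (b - a)]%classic; split => //.
    move=> ? [y [Ny Fy] <-]; rewrite /= in_itv/= -ler_distlC.
    rewrite (le_trans (lip _ _ Nx Ny))// ler_wpM2l//.
    move: Fx Fy; rewrite Fab/= !in_itv/= => /andP[ax xb] /andP[ay yb].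
    by rewrite ler_norml; apply/andP; split; lra.
  rewrite lebesgue_measure_itv/= Fab wlength_itv/= !lte_fin ab.
  have ba0 : 0 < b - a by rewrite subr_gt0.
  case: ifPn => _; last by rewrite -EFinB -EFinM lee_fin mulr_ge0 ?ltW.
  rewrite -!EFinB -EFinM lee_fin /C; nra.
have [I HI] := choice cover.
have NI : phi @` N `<=` \bigcup_k I k.
  move=> _ [x Nx <-]; have [k _ Fkx] := NF _ Nx.
  by exists k => //; have [_ + _] := HI k; apply; exists x.
have le1 : ((wlength idfun)^* (phi @` N) <= (wlength idfun)^* (\bigcup_k I k))%mu%E.
  exact: le_outer_measure.
apply: (le_trans le1).
apply: (le_trans (outer_measure_sigma_subadditive mu I)).
apply: (@le_trans _ _ (\sum_(k <oo) (C%:E * wlength idfun (F k)))%E).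
  apply: lee_nneseries => k _ /=.
    by move=> _; exact: outer_measure_ge0.
  by have [] := HI k.
rewrite nneseriesZl => [|k _]; last exact: wlength_ge0.
have -> : e%:E = (C%:E * (e / C)%:E)%E by rewrite -EFinM mulrC divfK// gt_eqF.
by rewrite lee_wpmul2l ?lee_fin ?(ltW C0)// ltW.
Qed.

(** The inverse is not Lipschitz near 0, but it is so with constant [(k+1)^2] on
    [1/(k+1), oo[; countably many of these half-lines cover the positive reals. *)
Lemma inv_negligible N : mu.-negligible N ->
  mu.-negligible [set t | 0 < t /\ N t^-1].
Proof.
move=> N0.
pose D (k : nat) : set R := [set t | k.+1%:R^-1 <= t /\ N t].
have : mu.-negligible (\bigcup_k (GRing.inv @` D k)).
  apply: negligible_bigcup => k.
  apply: (@lipschitz_image_negligible _ (k.+1%:R ^+ 2)); first by rewrite exprn_ge0.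
    move=> x y [kx _] [ky _].
    have k0 : 0 < k.+1%:R^-1 :> R by rewrite invr_gt0.
    have x0 := lt_le_trans k0 kx; have y0 := lt_le_trans k0 ky.
    have -> : x^-1 - y^-1 = (y - x) * (x^-1 * y^-1).
      by field; rewrite !gt_eqF.
    rewrite normrM distrC mulrC ler_wpM2r//.
    have le_k (z : R) : 0 < z -> k.+1%:R^-1 <= z -> z^-1 <= k.+1%:R.
      by move=> z0 kz; rewrite invf_ple ?posrE.
    rewrite ger0_norm; last by rewrite mulr_ge0// invr_ge0 ltW.
    by rewrite expr2; apply: ler_pM; rewrite ?invr_ge0 ?(ltW x0) ?(ltW y0)// le_k.
  by apply: negligibleS N0 => x [].
apply: negligibleS => t /= [t0 Nt].
exists (Num.truncn t) => //; exists t^-1; last by rewrite invrK.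
split => //; rewrite lef_pV2 ?posrE//; apply: ltW; exact: truncnS_gt.
Qed.

Lemma ae_inv (P : R -> Prop) : {ae mu, forall s : R, 0 < s -> P s} ->
  {ae mu, forall t : R, 0 < t -> P t^-1}.
Proof.
move=> /inv_negligible; apply: negligibleS => t /= /not_implyP[t0 nP].
by split => //; apply/not_implyP; split => //; rewrite invr_gt0.
Qed.

Lemma ae_exists_between (P : R -> Prop) (a b : R) : a < b ->
  {ae mu, forall s, P s} -> exists2 s, a < s < b & P s.
Proof.
move=> ab aeP; apply: contrapT => noP.
have : mu.-negligible `]a, b[.
  apply: negligibleS aeP.
  by move=> s; rewrite /= in_itv/= => sab Ps; apply: noP; exists s.
move=> ab0; have : (mu `]a, b[%classic = 0)%E by exact: measure_negligible.
rewrite lebesgue_measure_itv/= lte_fin ab -EFinB => -[] /eqP.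
by rewrite subr_eq0 gt_eqF.
Qed.

Lemma ae_imply (P Q : R -> Prop) : (forall s, P s -> Q s) ->
  {ae mu, forall s, P s} -> {ae mu, forall s, Q s}.
Proof. by move=> PQ; apply: negligibleS => s nQ /PQ. Qed.

Lemma ae_imply2 (P Q S : R -> Prop) : (forall s, P s -> Q s -> S s) ->
  {ae mu, forall s, P s} -> {ae mu, forall s, Q s} -> {ae mu, forall s, S s}.
Proof.
move=> PQS aeP aeQ; have := negligibleU aeP aeQ; apply: negligibleS => s nS.
by apply: contrapT => /not_orP[/contrapT Ps /contrapT Qs]; exact/nS/PQS.
Qed.
End NullSets.

(** * Inner product, maximum norm and orthogonal projection *)

Section Dot.
Context {R : realType} {n : nat}.
Notation E := ('rV[R]_n).
Implicit Types (x y z : E) (a : R).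

Lemma dotC x y : dot x y = dot y x.
Proof. by apply: eq_bigr => i _; rewrite mulrC. Qed.

Lemma dotDl x y z : dot (x + y) z = dot x z + dot y z.
Proof. by rewrite -big_split; apply: eq_bigr => i _; rewrite mxE mulrDl. Qed.

Lemma dotZl a x y : dot (a *: x) y = a * dot x y.
Proof. by rewrite mulr_sumr; apply: eq_bigr => i _; rewrite mxE mulrA. Qed.

Lemma dotDr x y z : dot z (x + y) = dot z x + dot z y.
Proof. by rewrite dotC dotDl !(dotC z). Qed.

Lemma dotZr a x y : dot y (a *: x) = a * dot y x.
Proof. by rewrite dotC dotZl (dotC y). Qed.

Lemma dotNl x y : dot (- x) y = - dot x y.
Proof. by rewrite -scaleN1r dotZl mulN1r. Qed.

Lemma dotNr x y : dot y (- x) = - dot y x.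
Proof. by rewrite -scaleN1r dotZr mulN1r. Qed.

Lemma dotBl x y z : dot (x - y) z = dot x z - dot y z.
Proof. by rewrite dotDl dotNl. Qed.

Lemma dotBr x y z : dot z (x - y) = dot z x - dot z y.
Proof. by rewrite dotDr dotNr. Qed.

Lemma dot0l y : dot 0 y = 0.
Proof. by rewrite -(scale0r y) dotZl mul0r. Qed.

Lemma normr_coord_le x i : `|x ord0 i| <= `|x|.
Proof.
rewrite [X in _ <= X]mx_normrE.
exact: (le_bigmax _ (fun k : 'I_1 * 'I_n => `|x k.1 k.2|) (ord0, i)).
Qed.

Lemma normr_mx_le x a : 0 <= a -> (forall i, `|x ord0 i| <= a) -> `|x| <= a.
Proof.
move=> a0 xa; rewrite [X in X <= _]mx_normrE.
by apply: bigmax_le => // -[i j] _ /=; rewrite ord1.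
Qed.

Lemma normr_dot_le x y : `|dot x y| <= n%:R * (`|x| * `|y|).
Proof.
apply: (le_trans (ler_norm_sum _ _ _)).
rewrite mulr_natl -[X in _ *+ X](card_ord n) -sumr_const.
by apply: ler_sum => i _; rewrite normrM ler_pM// normr_coord_le.
Qed.

Lemma sqr_normr_le_dot x : `|x| ^+ 2 <= dot x x.
Proof.
have dot0 : 0 <= dot x x by apply: sumr_ge0 => i _; rewrite -expr2 sqr_ge0.
rewrite -[leRHS]sqr_sqrtr// ler_pXn2r ?nnegrE ?sqrtr_ge0//.
apply: normr_mx_le => [|i]; first exact: sqrtr_ge0.
rewrite -sqrtr_sqr ler_wsqrtr// /dot (bigD1 i)//= -expr2 lerDl.
by apply: sumr_ge0 => j _; rewrite -expr2 sqr_ge0.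
Qed.

Lemma dot_eq0 x : dot x x = 0 -> x = 0.
Proof.
move=> xx; have := sqr_normr_le_dot x; rewrite xx => x0.
by apply: normr0_eq0; apply/eqP; rewrite -sqrf_eq0 eq_le x0 sqr_ge0.
Qed.

(** The Euclidean bound [|x|^2 = y.x <= |y||x|]; the factor [n] is the price of
    using the maximum norm. *)
Lemma dot_le_normr (x y : E) : dot x x = dot y x -> `|x| <= n%:R * `|y|.
Proof.
move=> xy; have := sqr_normr_le_dot x; rewrite xy => H.
have {}H : `|x| * `|x| <= (n%:R * `|y|) * `|x|.
  by rewrite -expr2 (le_trans H)// (le_trans (ler_norm _))// (le_trans (normr_dot_le _ _))// mulrA.
have [->|x0] := eqVneq x 0; first by rewrite normr0 mulr_ge0.
by rewrite -(ler_pM2r (x := `|x|)) ?normr_gt0.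
Qed.

(** Two candidates for the projection differ by an element of [V] that is
    orthogonal to [V], hence to itself. *)
Lemma orth_projP (V : set E) x z : (forall y y', V y -> V y' -> V (y - y')) ->
  V z -> (forall y, V y -> dot (x - z) y = 0) -> orth_proj V x = z.
Proof.
move=> VB Vz xz; rewrite /orth_proj.
have /(xgetPex 0)[] : [set z' | V z' /\ forall y, V y -> dot (x - z') y = 0] !=set0.
  by exists z.
set z' := xget _ _ => Vz' xz'.
apply/eqP; rewrite -subr_eq0; apply/eqP/dot_eq0.
rewrite {1}(_ : z' - z = (x - z) - (x - z')); last by rewrite opprB [RHS]addrC subrKA.
by rewrite dotBl xz ?xz' ?subrr//; exact: VB.
Qed.
End Dot.

(** * The polar set of a seminorm *)

Section Seminorm.
Context {R : realType} {n : nat}.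
Notation E := ('rV[R]_n).
Variable J : E -> R.
Hypotheses (J_ge0 : forall x, 0 <= J x) (J_hom : abs_homogeneous1 J).

(** The subdifferential of [J] at the origin, i.e. the dual unit ball. *)
Definition polar : set E := [set p | forall y, dot p y <= J y].

Lemma seminorm0 : J 0 = 0.
Proof. by rewrite -(scale0r 0) J_hom normr0 mul0r. Qed.

Lemma seminormN x : J (- x) = J x.
Proof. by rewrite -scaleN1r J_hom normrN1 mul1r. Qed.

(** Convexity at the midpoint, rescaled by homogeneity. *)
Lemma subadditive_of_convex : convex_function setT J ->
  forall x y, J (x + y) <= J x + J y.
Proof.
move=> Jc x y.
have h0 : 0 <= 2^-1 :> R by rewrite invr_ge0.
have h1 : 2^-1 <= 1 :> R by rewrite invf_le1 ?ler1n.
have := Jc (Itv01 h0 h1) x y; rewrite !inE => /(_ I I).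
rewrite convRE /= /conv/=.
have -> : unstable.onem 2^-1 = 2^-1 :> R by rewrite /unstable.onem; lra.
rewrite -scalerDr J_hom ger0_norm ?invr_ge0// -mulrDr.
by rewrite ler_pM2l// invr_gt0.
Qed.

Lemma polar_dot_normr p y : polar p -> `|dot p y| <= J y.
Proof.
move=> Kp; rewrite ler_norml Kp andbT lerNl -dotNr -(seminormN y); exact: Kp.
Qed.

Lemma polar_orthogonal p y : polar p -> nullspace J y -> dot p y = 0.
Proof.
move=> Kp Jy; apply: normr0_eq0; apply/eqP; rewrite eq_le normr_ge0 andbT -[leRHS]Jy.
exact: polar_dot_normr.
Qed.

(** The subgradient inequality at [0] and at [2 x] gives [p.x = J x]; what remains
    of it is then membership in the polar set. *)
Lemma subdifferential_polar x p : subdifferential J x p -> dot p x = J x /\ polar p.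
Proof.
move=> px; have px1 : dot p x = J x.
  apply/eqP; rewrite eq_le; apply/andP; split.
    have := px (2 *: x); rewrite J_hom ger0_norm// dotBr dotZr; lra.
  by have := px 0; rewrite seminorm0 sub0r dotNr subr_le0.
by split=> // y; have := px y; rewrite dotBr px1 addrCA subrr addr0.
Qed.

Lemma polar_comb m (c : 'I_m -> R) (k : 'I_m -> E) : (forall i, polar (k i)) ->
  \sum_(i < m) `|c i| <= 1 -> polar (\sum_(i < m) c i *: k i).
Proof.
move=> Kk c1 y.
have -> : dot (\sum_(i < m) c i *: k i) y = \sum_(i < m) c i * dot (k i) y.
  elim/big_ind2 : _ => [|? ? ? ? <- <-|i _]; first exact: dot0l.
    by rewrite dotDl.
  exact: dotZl.
apply: (@le_trans _ _ (\sum_(i < m) `|c i| * J y)).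
  apply: ler_sum => i _; rewrite (le_trans (ler_norm _))// normrM ler_wpM2l//.
  exact: polar_dot_normr.
by rewrite -mulr_suml ler_piMl.
Qed.

(** A largest linearly independent family in the polar set spans it. *)
Lemma polar_basis : exists r (A : 'M[R]_(r, n)),
  (forall i, polar (row i A)) /\ forall p, polar p -> (p <= A)%MS.
Proof.
pose Q r := `[< exists A : 'M[R]_(r, n), (forall i, polar (row i A)) /\ row_free A >].
have Q0 : exists r, Q r.
  exists 0%N; apply/asboolP; exists 0; split => [[]//|].
  by rewrite /row_free mxrank0.
have Qn r : Q r -> (r <= n)%N.
  by move=> /asboolP[A [_ /eqP <-]]; exact: rank_leq_col.
have [r /asboolP[A [KA freeA]] rmax] := ex_maxnP Q0 Qn.
exists r, A; split=> // p Kp; apply/negPn/negP => pA.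
suff /rmax : Q (r + 1)%N by rewrite addn1 ltnn.
apply/asboolP; exists (col_mx A p); split.
  move=> i; rewrite -[i](splitK i); case: (fintype.split i) => j /=.
    by rewrite rowKu.
  by rewrite rowKd row_id.
rewrite /row_free eqn_leq rank_leq_row/= -addsmxE addn1.
have : (A < A + p)%MS.
  rewrite ltmxE addsmxSl/=; apply: contra pA => /(submx_trans _); apply.
  exact: addsmxSr.
by rewrite ltmxErank (eqP freeA) => /andP[].
Qed.

(** The coordinates of [p] in a basis taken from the polar set depend linearly on
    [p]; when [p] is small, twice these coordinates sum to at most 1 in absolute
    value, so [2 p] is an absolutely convex combination of basis elements.  This is
    where finite dimension enters. *)
Lemma polar_double : exists2 d : R, 0 < d &
  forall p, polar p -> `|p| <= d -> polar (2 *: p).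
Proof.
have [r [A [KA spanA]]] := polar_basis.
pose C := \sum_(i < r) \sum_(j < n) `|pinvmx A j i|.
have C0 : 0 <= C by do 2 (apply: sumr_ge0 => ? _).
exists (2 * (C + 1))^-1; first by rewrite invr_gt0 mulr_gt0// ltr_wpDl.
move=> p Kp pd.
have -> : 2 *: p = \sum_(i < r) (2 * (p *m pinvmx A) ord0 i) *: row i A.
  rewrite -{1}(mulmxKpV (spanA p Kp)) mulmx_sum_row scaler_sumr.
  by apply: eq_bigr => i _; rewrite scalerA.
apply: polar_comb => //.
apply: (@le_trans _ _ (2 * (`|p| * C))).
  rewrite /C !mulr_sumr; apply: ler_sum => i _.
  rewrite normrM ger0_norm// ler_wpM2l// mxE (le_trans (ler_norm_sum _ _ _))//.
  rewrite mulr_sumr; apply: ler_sum => j _; rewrite normrM ler_wpM2r//.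
  exact: normr_coord_le.
have := C0; have : 2 * (C + 1) * `|p| <= 1.
  by rewrite -ler_pdivlMl ?mulr1// mulr_gt0// ltr_wpDl.
have := normr_ge0 p; nra.
Qed.
End Seminorm.

(** * Bounds for the inverse scale space flow *)

Section FlowProperties.
Context {R : realType} {n : nat}.
Notation E := ('rV[R]_n).
Notation mu := (@lebesgue_measure R).

(** The vanishing of the derivative at an interior maximum, when differentiability
    is only known at the point itself: the first order expansion at two points
    placed symmetrically around [s] gives both inequalities. *)
Lemma is_derive_dot_max (q : R -> E) (s : R) (d y : E) (r : R) :
  is_derive s 1 q d -> 0 < r ->
  (forall t, `|t - s| < r -> dot (q t) y <= dot (q s) y) -> dot d y = 0.
Proof.
move=> qd r0 qmax; apply: normr0_eq0; apply/eqP.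
rewrite eq_le normr_ge0 andbT; apply/ler_addgt0Pr => e e0; rewrite add0r.
pose C := n%:R * `|y| + 1.
have C0 : 0 < C by rewrite ltr_wpDl// mulr_ge0.
have [r' r'0 qr'] := is_derive_expansion qd (divr_gt0 e0 C0).
have key t : `|t - s| < Num.min r r' -> (t - s) * dot d y <= e * `|t - s|.
  rewrite lt_min => /andP[tr tr'].
  have := qr' _ tr'; set w := _ - _ *: d => we.
  have -> : (t - s) * dot d y = dot (q t) y - dot (q s) y - dot w y.
    by rewrite !dotBl dotZl; ring.
  have := qmax _ tr.
  have : - dot w y <= e * `|t - s|.
    rewrite (le_trans (ler_norm _))// normrN (le_trans (normr_dot_le _ _))//.
    apply: (@le_trans _ _ (n%:R * (e / C * `|t - s| * `|y|))).
      by rewrite ler_wpM2l// ler_wpM2r.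
    have -> : n%:R * (e / C * `|t - s| * `|y|) = e * `|t - s| * (n%:R * `|y| / C).
      by field; rewrite gt_eqF.
    by rewrite ler_piMr ?mulr_ge0 ?(ltW e0)// ler_pdivrMr// mul1r lerDl.
  lra.
pose h := Num.min r r' / 2.
have m0 : 0 < Num.min r r' by rewrite lt_min r0.
have h0 : 0 < h by rewrite divr_gt0.
have hm : h < Num.min r r' by rewrite ltr_pdivrMr// ltr_pMr// ltr1n.
have := key (s + h); have := key (s - h).
have -> : s + h - s = h by ring.
have -> : s - h - s = - h by ring.
rewrite normrN (gtr0_norm h0) => /(_ hm) + /(_ hm).
by rewrite mulNr -mulrN ![e * h]mulrC !ler_pM2l// => H1 H2; rewrite ler_norml H2 andbT lerNl.
Qed.

Lemma abs_continuous_on_continuity (a b : R) (q : R -> E) :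
  abs_continuous_on a b q -> forall e : R, 0 < e -> exists2 d : R, 0 < d &
    forall x y, a <= x -> x <= y -> y <= b -> y - x < d -> `|q y - q x| < e.
Proof.
move=> acq e /acq[d d0 H]; exists d => // x y ax xy yb yxd.
have := H 1%N (fun=> x) (fun=> y); rewrite !big_ord_recl !big_ord0 !addr0.
by apply=> //; apply/trivIsetP => i j _ _; rewrite !ord1 eqxx.
Qed.

Variables (J : E -> R) (f : E) (q v : R -> E).
Hypotheses (J_ge0 : forall x, 0 <= J x) (J_hom : abs_homogeneous1 J)
  (J_convex : convex_function setT J)
  (flow : inverse_scale_space_flow J f q v).

(** At almost every time this is part of the subgradient condition; times where
    it may fail are limits of such times, and the polar set is closed. *)
Lemma flow_polar s : 0 <= s -> polar J (q s).
Proof.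
move=> s0 y.
have [acq _ _ subJ _] := flow.
have s1 : 0 < s + 1 by rewrite ltr_wpDl.
apply/ler_addgt0Pr => e e0.
pose C := n%:R * `|y| + 1.
have C0 : 0 < C by rewrite ltr_wpDl// mulr_ge0.
have [d d0 qd] := abs_continuous_on_continuity (acq _ s1) (divr_gt0 e0 C0).
have [t /andP[st td] tJ] : exists2 t, s < t < s + Num.min d 1 &
    0 < t -> subdifferential J (v t) (q t).
  by apply: ae_exists_between => //; rewrite ltrDl lt_min d0 ltr01.
have := td; rewrite -ltrBlDl lt_min => /andP[tsd ts1].
have [_ Kt] := subdifferential_polar J_hom (tJ (le_lt_trans s0 st)).
have : dot (q s) y = dot (q t) y - dot (q t - q s) y by rewrite dotBl; ring.
have := Kt y.
have : `|dot (q t - q s) y| <= e.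
  rewrite (le_trans (normr_dot_le _ _))//.
  apply: (@le_trans _ _ (n%:R * (e / C * `|y|))).
    rewrite ler_wpM2l// ler_wpM2r// ltW// qd ?(ltW st)//; lra.
  have -> : n%:R * (e / C * `|y|) = e * (n%:R * `|y| / C).
    by field; rewrite gt_eqF.
  by rewrite ler_piMr ?(ltW e0)// ler_pdivrMr// mul1r lerDl.
rewrite ler_norml => /andP[]; lra.
Qed.

(** The function [r |-> q(r).v(s)] is bounded by [J(v(s))] and attains this
    bound at [r = s]; the function [r |-> q(r).y] is constant for [y] in the null
    space.  Both have derivative zero at [s], and the derivative of [q] is
    [f - v]. *)
Lemma flow_velocity_orthogonal : {ae mu, forall s, 0 < s ->
  dot (f - v s) (v s) = 0 /\ forall y, nullspace J y -> dot (f - v s) y = 0}.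
Proof.
have [_ _ + + _] := flow.
apply: ae_imply2 => s qv qJ s0.
have {}qv := qv s0; have [qvJ _] := subdifferential_polar J_hom (qJ s0).
have pos t : `|t - s| < s -> polar J (q t).
  by rewrite ltr_distl subrr => /andP[t0 _]; apply: flow_polar; exact: ltW.
split=> [|y Jy]; apply: (is_derive_dot_max qv s0) => t /pos Kt.
  by rewrite qvJ; exact: Kt.
by rewrite !(polar_orthogonal J_hom _ Jy)//; exact/flow_polar/ltW.
Qed.

Lemma flow_bounded : {ae mu, forall s, 0 < s -> `|v s| <= n%:R * `|f|}.
Proof.
apply: ae_imply flow_velocity_orthogonal => s + s0 => /(_ s0)[+ _].
by rewrite dotBl => /subr0_eq fv; exact: dot_le_normr.
Qed.

(** A bound for [|f - v|], hence for the speed of [q]. *)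
Definition flow_speed : R := `|f| + n%:R * `|f|.

Lemma flow_lipschitz x y : 0 <= x -> x <= y ->
  `|q y - q x| <= flow_speed * (y - x).
Proof.
move=> x0 xy; have [acq _ qder _ _] := flow.
have y1 : 0 < y + 1 by rewrite ltr_wpDl// (le_trans x0).
have M0 : 0 <= flow_speed by rewrite addr_ge0// mulr_ge0.
apply: abs_continuous_increment_le => //.
  by apply: abs_continuous_onS (acq _ y1) => //; rewrite lerDl.
apply: ae_imply2 flow_bounded qder => s vb qs xs.
have s0 := le_lt_trans x0 xs.
exists (f - v s); last exact: qs.
by rewrite (le_trans (ler_normB _ _))// lerD2l vb.
Qed.

(** For small [s] also [2 q(s)] is in the polar set, so that
    [2 J(v(s)) = 2 q(s).v(s) <= J(v(s))] and [v(s)] is in the null space; the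
    orthogonality of [f - v(s)] to the null space makes it the projection. *)
Lemma flow_initially_projection : exists2 d : R, 0 < d &
  {ae mu, forall s, 0 < s -> s <= d -> v s = orth_proj (nullspace J) f}.
Proof.
have [r r0 dbl] := polar_double J_ge0 J_hom.
have M1 : 0 < flow_speed + 1 by rewrite ltr_wpDl// addr_ge0// mulr_ge0.
exists (r / (flow_speed + 1)); first by rewrite divr_gt0.
have [_ _ _ qJ q0] := flow.
apply: ae_imply2 flow_velocity_orthogonal qJ => s vorth qJ s0 sr.
have [_ vN] := vorth s0.
have [qvJ Kq] := subdifferential_polar J_hom (qJ s0).
have K2q : polar J (2 *: q s).
  apply: dbl => //; have := flow_lipschitz (lexx 0) (ltW s0).
  rewrite q0 !subr0 => /le_trans; apply.
  by move: sr; rewrite ler_pdivlMr// mulrDr mulr1 mulrC; lra.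
symmetry; apply: orth_projP.
- move=> y y' Jy Jy'; apply/eqP; rewrite eq_le J_ge0 andbT.
  rewrite (le_trans (subadditive_of_convex J_hom J_convex _ _))//.
  by rewrite (seminormN J_hom) Jy Jy' addr0.
- apply/eqP; rewrite eq_le J_ge0 andbT.
  by have := K2q (v s); rewrite dotZl qvJ; lra.
- exact: vN.
Qed.

Lemma u_IS_bounded : {ae mu, forall t, 0 < t -> `|u_IS v t| <= n%:R * `|f|}.
Proof. exact: ae_inv flow_bounded. Qed.

Lemma p_IS_lipschitz t0 : 0 < t0 -> [lipschitz p_IS q t | t in `[t0, +oo[].
Proof.
move=> t00; apply: (@klipschitzW _ _ _ (flow_speed / t0 ^+ 2)).
  by apply: (@globally_properfilter _ _ (t0, t0)); split; rewrite /= in_itv/= lexx.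
have M0 : 0 <= flow_speed by rewrite addr_ge0// mulr_ge0.
have main x y : t0 <= x -> x <= y ->
    `|p_IS q x - p_IS q y| <= flow_speed / t0 ^+ 2 * `|x - y|.
  move=> tx xy.
  have x0 := lt_le_trans t00 tx; have y0 := lt_le_trans x0 xy.
  rewrite /p_IS (le_trans (flow_lipschitz _ _)) ?invr_ge0 ?(ltW y0)//.
    by rewrite lef_pV2.
  rewrite -mulrA ler_wpM2l// distrC ger0_norm ?subr_ge0//.
  have -> : x^-1 - y^-1 = (x^-1 * y^-1) * (y - x) by field; rewrite !gt_eqF.
  rewrite ler_wpM2r ?subr_ge0// -invfM lef_pV2 ?posrE ?mulr_gt0//.
  by rewrite expr2 ler_pM ?(ltW t00)// (le_trans tx).
move=> [x y] /= []; rewrite !in_itv/= !andbT => tx ty.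
have [xy|/ltW yx] := leP x y; first exact: main.
by rewrite distrC (distrC x); exact: main.
Qed.

Lemma extinction_time_exists : exists T, extinction_time J f v T.
Proof.
have [d d0 vd] := flow_initially_projection.
exists d^-1; split; first by rewrite invr_ge0 ltW.
apply: ae_imply (ae_inv vd) => t + dt.
have t0 : 0 < t by rewrite (lt_le_trans _ dt)// invr_gt0.
by move=> /(_ t0); apply; rewrite invf_ple.
Qed.
End FlowProperties.

(** * Integrability of products with bounded functions *)

Section Integrability.
Context {R : realType}.
Notation mu := (@lebesgue_measure R).
Implicit Types (D : set R) (h k : R -> R) (C : R).

Lemma bounded_in D k C : (forall t, D t -> `|k t| <= C) -> [bounded k t | t in D].
Proof.
move=> kC; exists C; split; first exact: num_real.
by move=> M CM t Dt; rewrite /= (le_trans (kC t Dt))// ltW.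
Qed.

Lemma integrable_bounded D k C : measurable D -> (mu D < +oo)%E ->
  measurable_fun D k -> (forall t, D t -> `|k t| <= C) ->
  mu.-integrable D (EFin \o k).
Proof.
move=> mD Doo mk kC; apply: measurable_bounded_integrable => //.
exact: bounded_in kC.
Qed.

Lemma integrable_funM_bounded D h k C : measurable D -> mu.-integrable D (EFin \o h) ->
  measurable_fun D k -> (forall t, D t -> `|k t| <= C) ->
  mu.-integrable D (EFin \o (fun t => h t * k t)).
Proof.
move=> mD ih mk kC.
have := @integrableMl _ _ _ mu _ mD _ _ ih mk (bounded_in kC).
by apply: eq_integrable => // t _; rewrite /= EFinM.
Qed.

Lemma integrable_funD D h k : measurable D -> mu.-integrable D (EFin \o h) ->
  mu.-integrable D (EFin \o k) -> mu.-integrable D (EFin \o (fun t => h t + k t)).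
Proof.
move=> mD ih ik; apply: (@eq_integrable _ _ _ mu D mD ((EFin \o h) \+ (EFin \o k))%E) => //.
exact: integrableD.
Qed.

Lemma integrable_funB D h k : measurable D -> mu.-integrable D (EFin \o h) ->
  mu.-integrable D (EFin \o k) -> mu.-integrable D (EFin \o (fun t => h t - k t)).
Proof.
move=> mD ih ik; apply: (@eq_integrable _ _ _ mu D mD ((EFin \o h) \- (EFin \o k))%E) => //.
exact: integrableB.
Qed.

Lemma integrable_funZ D h C : measurable D -> mu.-integrable D (EFin \o h) ->
  mu.-integrable D (EFin \o (fun t => C * h t)).
Proof.
move=> mD ih; apply: (@eq_integrable _ _ _ mu D mD (fun t => C%:E * (EFin \o h) t)%E) => //.
exact: integrableZl.
Qed.

Lemma itv_finite (a b : R) (b0 b1 : bool) :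
  (mu [set` Interval (BSide b0 a) (BSide b1 b)] < +oo)%E.
Proof. by rewrite lebesgue_measure_itv/=; case: ifP => _; rewrite ?ltry. Qed.
End Integrability.

(** * Smooth bumps *)

Section TestFunctions.
Context {R : realType}.
Notation mu := (@lebesgue_measure R).
Implicit Types (r u x y t : R).

Definition ppart u : R := Num.max 0 u.

(** The tent of height [1/r] and integral 1 over [-r, r].  As a second difference
    of the positive part it inherits its regularity from that function alone. *)
Definition hat r u : R := (ppart (u + r) - 2 * ppart u + ppart (u - r)) / r ^+ 2.

(** The primitive of [hat r] rising from 0 to 1: the same second difference,
    applied to [u_+^2 / 2]. *)
Definition ramp r u : R :=
  (ppart (u + r) ^+ 2 - 2 * ppart u ^+ 2 + ppart (u - r) ^+ 2) / (2 * r ^+ 2).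

Lemma ppart_ge u : 0 <= u -> ppart u = u.
Proof. by rewrite /ppart => /max_idPr. Qed.

Lemma ppart_le u : u <= 0 -> ppart u = 0.
Proof. by rewrite /ppart => /max_idPl. Qed.

Lemma hat_out r u : 0 < r -> r <= `|u| -> hat r u = 0.
Proof.
move=> r0; rewrite /hat ler_normr => /orP[ru|ru].
  by rewrite !ppart_ge; [field; rewrite gt_eqF|lra|lra|lra].
by rewrite !ppart_le; [field; rewrite gt_eqF|lra|lra|lra].
Qed.

Lemma ramp_left r u : 0 < r -> u <= - r -> ramp r u = 0.
Proof.
by move=> r0 ur; rewrite /ramp !ppart_le; [field; rewrite gt_eqF|lra|lra|lra].
Qed.

Lemma ramp_right r u : 0 < r -> r <= u -> ramp r u = 1.
Proof.
by move=> r0 ur; rewrite /ramp !ppart_ge; [field; rewrite gt_eqF|lra|lra|lra].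
Qed.

Lemma hat_bound r u : 0 < r -> 0 <= hat r u <= r^-1.
Proof.
move=> r0; rewrite /hat divr_ge0 ?sqr_ge0//=; last first.
  have [u0|u0] := leP 0 u.
    rewrite (ppart_ge u0) ppart_ge; last by lra.
    have [?|?] := leP 0 (u - r); [rewrite ppart_ge//|rewrite ppart_le//]; lra.
  rewrite (ppart_le (ltW u0)) (@ppart_le (u - r)); last by lra.
  have [?|?] := leP 0 (u + r); [rewrite ppart_ge//|rewrite ppart_le//]; lra.
have -> : r^-1 = r / r ^+ 2 by field; rewrite gt_eqF.
rewrite ler_pM2r ?invr_gt0 ?exprn_gt0//.
have [u0|u0] := leP 0 u.
  rewrite (ppart_ge u0) ppart_ge; last by lra.
  have [?|?] := leP 0 (u - r); [rewrite ppart_ge//|rewrite ppart_le//]; lra.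
rewrite (ppart_le (ltW u0)) (@ppart_le (u - r)); last by lra.
have [?|?] := leP 0 (u + r); [rewrite ppart_ge//|rewrite ppart_le//]; lra.
Qed.

Lemma ramp_bound r u : 0 < r -> 0 <= ramp r u <= 1.
Proof.
move=> r0; have [ur|ur] := leP u (- r); first by rewrite ramp_left// lexx ler01.
have [ru|ru] := leP r u; first by rewrite ramp_right// lexx ler01.
have d0 : 0 < 2 * r ^+ 2 by rewrite mulr_gt0// exprn_gt0.
rewrite /ramp ler_pdivlMr// mul0r ler_pdivrMr// mul1r.
rewrite (@ppart_ge (u + r)) ?(@ppart_le (u - r)); [|lra|lra].
have [u0|u0] := leP 0 u; [rewrite ppart_ge//|rewrite ppart_le ?(ltW u0)//]; nra.
Qed.

(** A quadratic bound on the remainder passes to the linear combinations and shifts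
    of [u_+^2] that define [ramp] and [bump], and holds for [u_+^2] although this
    function is not twice differentiable. *)
Lemma is_derive_quadratic (F : R -> R) (d C : R) x :
  (forall h, `|F (x + h) - F x - h * d| <= C * h ^+ 2) -> is_derive x 1 F d.
Proof.
move=> H.
have cvF : h^-1 *: (F (h *: 1 + x) - F x) @[h --> 0^'] --> d.
  apply/cvgrPdist_le => e e0.
  have C1 : 0 < `|C| + 1 by rewrite ltr_wpDl.
  exists (e / (`|C| + 1)) => /=; first by rewrite divr_gt0.
  move=> h; rewrite /ball_/= sub0r normrN => hd h0.
  have -> : d - h^-1 *: (F (h *: 1 + x) - F x) = - (F (x + h) - F x - h * d) / h.
    rewrite -[_ *: 1]/(_ * 1) mulr1 -[_ *: _]/(_ * _) (addrC h); field; exact: h0.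
  rewrite normrM normrN normfV ler_pdivrMr ?normr_gt0//.
  rewrite (le_trans (H h))// -real_normK ?num_real// expr2 mulrA ler_wpM2r//.
  apply: (@le_trans _ _ ((`|C| + 1) * `|h|)).
    by rewrite ler_wpM2r// (le_trans (ler_norm _))// lerDl.
  by rewrite -ler_pdivlMl// mulrC ltW.
apply: DeriveDef; first by apply/cvg_ex; exists d.
by apply/cvg_lim => //; exact: norm_hausdorff.
Qed.

Lemma ppart_sq_expansion u h :
  `|ppart (u + h) ^+ 2 - ppart u ^+ 2 - 2 * h * ppart u| <= h ^+ 2.
Proof.
rewrite ler_norml; have [u0|u0] := leP 0 u.
  rewrite (ppart_ge u0).
  by have [?|/ltW ?] := leP 0 (u + h); [rewrite ppart_ge//|rewrite ppart_le//];
    apply/andP; split; nra.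
rewrite (ppart_le (ltW u0)).
by have [?|/ltW ?] := leP 0 (u + h); [rewrite ppart_ge//|rewrite ppart_le//];
  apply/andP; split; nra.
Qed.

Lemma ramp_expansion r u h : 0 < r ->
  `|ramp r (u + h) - ramp r u - h * hat r u| <= 2 / r ^+ 2 * h ^+ 2.
Proof.
move=> r0.
have := ppart_sq_expansion (u + r) h; have := ppart_sq_expansion u h.
have := ppart_sq_expansion (u - r) h.
have -> : ramp r (u + h) - ramp r u - h * hat r u =
  ((ppart (u + r + h) ^+ 2 - ppart (u + r) ^+ 2 - 2 * h * ppart (u + r))
   - 2 * (ppart (u + h) ^+ 2 - ppart u ^+ 2 - 2 * h * ppart u)
   + (ppart (u - r + h) ^+ 2 - ppart (u - r) ^+ 2 - 2 * h * ppart (u - r)))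
    / (2 * r ^+ 2).
  rewrite /ramp /hat (addrAC u r h) (addrAC u (- r) h).
  by field; rewrite gt_eqF.
set A := _ - _ - _ * ppart (u - r); set B := _ - _ - _ * ppart u.
set D := _ - _ - _ * ppart (u + r) => HA HB HD.
have d0 : 0 < 2 * r ^+ 2 by rewrite mulr_gt0// exprn_gt0.
rewrite normrM normfV (gtr0_norm d0) ler_pdivrMr//.
have -> : 2 / r ^+ 2 * h ^+ 2 * (2 * r ^+ 2) = 4 * h ^+ 2.
  by field; rewrite gt_eqF.
by move: HA HB HD; rewrite !ler_norml => /andP[? ?] /andP[? ?] /andP[? ?]; lra.
Qed.

Lemma is_derive_ramp r a t : 0 < r ->
  is_derive t 1 (fun t => ramp r (t - a)) (hat r (t - a)).
Proof.
move=> r0; apply: is_derive_quadratic => h.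
by rewrite (addrAC t h); exact: ramp_expansion.
Qed.

Lemma continuous_ppart : continuous ppart.
Proof.
move=> u; apply/cvgrPdist_le => e e0; exists e => //= t tu.
rewrite (le_trans _ (ltW tu))// ler_norml.
have := ler_norm (u - t); have := ler_norm (- (u - t)); rewrite normrN.
have [u0|/ltW u0] := leP 0 u; [rewrite (ppart_ge u0)|rewrite (ppart_le u0)];
  (have [t0|/ltW t0] := leP 0 t; [rewrite (ppart_ge t0)|rewrite (ppart_le t0)]);
  move=> ? ?; apply/andP; split; lra.
Qed.

Lemma continuous_hat r a : continuous (fun t => hat r (t - a)).
Proof.
have cp b : continuous (fun t => ppart (t + b)).
  move=> t; apply: (@continuous_comp _ _ _ (fun t => t + b) ppart).
    by apply: cvgD; [exact: cvg_id|exact: cvg_cst].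
  exact: continuous_ppart.
move=> t; rewrite /hat; apply: cvgMl; apply: cvgD.
  apply: cvgB; last by apply: cvgMr; exact: cp.
  by under eq_fun do rewrite -addrA; rewrite -addrA; exact: cp.
by under eq_fun do rewrite -addrA; rewrite -addrA; exact: cp.
Qed.

Lemma measurable_hat r a (D : set R) : measurable_fun D (fun t => hat r (t - a)).
Proof.
apply: measurable_funTS; apply: continuous_measurable_fun.
exact: continuous_hat.
Qed.

(** A C^1 substitute for the indicator of ]x, y[: it climbs across the ball of
    radius [r] around [x] and descends across the one around [y]. *)
Definition bump r x y t : R := ramp r (t - x) - ramp r (t - y).

Lemma is_derive_bump r x y t : 0 < r ->
  is_derive t 1 (bump r x y) (hat r (t - x) - hat r (t - y)).
Proof.
move=> r0; apply: (@is_derive_quadratic _ _ (4 / r ^+ 2)) => h.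
have := @ramp_expansion r (t - x) h r0; have := @ramp_expansion r (t - y) h r0.
rewrite /bump (addrAC t h) (addrAC t h) => H1 H2.
have -> : 4 / r ^+ 2 * h ^+ 2 = 2 / r ^+ 2 * h ^+ 2 + 2 / r ^+ 2 * h ^+ 2 by ring.
rewrite (_ : _ - _ = (ramp r (t - x + h) - ramp r (t - x) - h * hat r (t - x))
  - (ramp r (t - y + h) - ramp r (t - y) - h * hat r (t - y))); last by ring.
by rewrite (le_trans (ler_normB _ _))// lerD.
Qed.

Lemma derive1_bump r x y : 0 < r ->
  derive1 (bump r x y) = (fun t => hat r (t - x) - hat r (t - y)).
Proof.
by move=> r0; apply/funext => t; rewrite derive1E; have [_ ->] := is_derive_bump x y t r0.
Qed.

Lemma test_function_bump T r x y : 0 < r -> r < x -> x <= y -> y + r < T ->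
  test_function T (bump r x y).
Proof.
move=> r0 rx xy yT; split.
- by move=> t; have [] := is_derive_bump x y t r0.
- rewrite derive1_bump// => t.
  by apply: cvgB; exact: continuous_hat.
- exists (x - r), (y + r); split => //; first by rewrite subr_gt0.
  move=> t; rewrite in_itv/= negb_and -!ltNge /bump => /orP[tx|ty].
    by rewrite !ramp_left ?subrr//; lra.
  by rewrite !ramp_right ?subrr//; lra.
Qed.

Lemma integral_hat r x : 0 < r ->
  \int[mu]_(t in ball x r) hat r (t - x) = 1.
Proof.
move=> r0; rewrite ball_itv Rintegral_itv_bndo_bndc ?Rintegral_itv_obnd_cbnd.
- rewrite /Rintegral (@continuous_FTC2 _ _ (fun t => ramp r (t - x))).
  + have -> : x + r - x = r by ring.
    have -> : x - r - x = - r by ring.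
    by rewrite ramp_right// ramp_left// -EFinB subr0.
  + by lra.
  + by apply: continuous_subspaceT; exact: continuous_hat.
  + have cr (a : R) : {for a, continuous (fun t => ramp r (t - x))}.
      apply: differentiable_continuous; apply/derivable1_diffP.
      by have [] := is_derive_ramp x a r0.
    split; last 2 first.
    * by apply: cvg_at_right_filter; exact: cr.
    * by apply: cvg_at_left_filter; exact: cr.
    by move=> t _; have [] := is_derive_ramp x t r0.
  + by move=> t _; rewrite derive1E; have [_ ->] := is_derive_ramp x t r0.
- by apply: (integrable_bounded (C := r^-1)) => // [||t _];
    [exact: itv_finite|exact: measurable_hat|];
    have /andP[? ?] := hat_bound (t - x) r0; rewrite ger0_norm.
- by apply: (integrable_bounded (C := r^-1)) => // [||t _];
    [exact: itv_finite|exact: measurable_hat|];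
    have /andP[? ?] := hat_bound (t - x) r0; rewrite ger0_norm.
Qed.
End TestFunctions.

(** * Weak derivatives at Lebesgue points *)

Section WeakDerivative.
Context {R : realType}.
Notation mu := (@lebesgue_measure R).
Implicit Types (D : set R) (h g k : R -> R) (r x y t T : R).

Lemma Rintegral_support D (P : set R) k : P `<=` D ->
  (forall t, ~ P t -> k t = 0) -> \int[mu]_(t in D) k t = \int[mu]_(t in P) k t.
Proof.
move=> PD k0; rewrite -[in RHS](setIidr PD) Rintegral_mkcondr.
apply: eq_Rintegral => t _; rewrite patchE; case: ifPn => // /negP tP.
by apply: k0 => Pt; apply: tP; rewrite inE.
Qed.

Lemma Rintegral_le_bound D h k : measurable D -> mu.-integrable D (EFin \o h) ->
  mu.-integrable D (EFin \o k) -> (forall t, D t -> `|h t| <= k t) ->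
  `|\int[mu]_(t in D) h t| <= \int[mu]_(t in D) k t.
Proof.
move=> mD ih ik hk; apply: (le_trans (@le_normr_Rintegral _ _ _ mu D h mD ih)).
by apply: le_Rintegral => //; exact: integrable_norm.
Qed.

(** Averaging against [hat r], which has integral 1 and is at most [1/r], deviates
    from [h x] by at most twice the mean oscillation of [h] on the ball of radius
    [r], which tends to 0 at a Lebesgue point. *)
Lemma mollify h x : mu.-integrable setT (EFin \o h) -> lebesgue_pt h x ->
  forall e : R, 0 < e -> exists2 d, 0 < d & forall r, 0 < r -> r < d ->
    `|\int[mu]_(t in ball x r) (h t * hat r (t - x)) - h x| <= e.
Proof.
move=> ih hx e e0.
have e20 : 0 < e / 2 by rewrite divr_gt0.
have [d /= d0 Hd] : \forall r \near 0^'+, (davg h x r < (e / 2)%:E)%E.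
  apply: (hx [set z | (z < (e / 2)%:E)%E]); exists (e / 2) => //= z.
  by rewrite /ball_ /= sub0r normrN lte_fin; exact: le_lt_trans (ler_norm _).
exists d => // r r0 rd.
have := Hd r; rewrite /ball_/= sub0r normrN gtr0_norm// => /(_ rd r0).
have mB : measurable (ball x r : set R) by exact: measurable_ball.
have Boo : (mu (ball x r) < +oo)%E by rewrite lebesgue_measure_ball ?ltry ?ltW.
have ihB : mu.-integrable (ball x r) (EFin \o h) by apply: integrableS ih.
have ic C : mu.-integrable (ball x r) (EFin \o (cst C)).
  by apply: (integrable_bounded (C := `|C|)).
have ihx : mu.-integrable (ball x r) (EFin \o (fun t => h t - h x)).
  exact: (integrable_funB (k := cst (h x))).
have mhat : measurable_fun (ball x r) (fun t => hat r (t - x)).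
  exact: measurable_hat.
have hatB t : `|hat r (t - x)| <= r^-1.
  by have /andP[? ?] := hat_bound (t - x) r0; rewrite ger0_norm.
have ihat : mu.-integrable (ball x r) (EFin \o (fun t => hat r (t - x))).
  by apply: (integrable_bounded (C := r^-1)) => //; exact: measurable_hat.
rewrite /davg /iavg lebesgue_measure_ball ?(ltW r0)//=.
have -> : (\int[mu]_(y in ball x r) `|(h y - h x)%:E| =
    (\int[mu]_(t in ball x r) `|h t - h x|)%:E)%E.
  rewrite /Rintegral fineK//; apply: integrable_fin_num => //.
  exact: integrable_norm.
rewrite inver mulrn_eq0/= gt_eqF// -EFinM lte_fin => He.
have -> : \int[mu]_(t in ball x r) (h t * hat r (t - x)) - h x =
    \int[mu]_(t in ball x r) ((h t - h x) * hat r (t - x)).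
  have {1}-> : h x = \int[mu]_(t in ball x r) (h x * hat r (t - x)).
    by rewrite RintegralZl// integral_hat// mulr1.
  rewrite -RintegralB//; last 2 first.
  - exact: (integrable_funM_bounded (C := r^-1) (k := fun t => hat r (t - x))).
  - exact: integrable_funZ.
  by apply: eq_Rintegral => t _; rewrite mulrBl.
apply: (@le_trans _ _ (\int[mu]_(t in ball x r) (r^-1 * `|h t - h x|))).
  apply: Rintegral_le_bound => //.
  - exact: (integrable_funM_bounded (C := r^-1) (h := fun t => h t - h x)
      (k := fun t => hat r (t - x))).
  - by apply: integrable_funZ => //; exact: integrable_norm.
  - by move=> t _; rewrite normrM mulrC ler_wpM2r.
rewrite RintegralZl//; last exact: integrable_norm.
move: He; rewrite -mulr_natr invfM.
set I := \int[mu]_(_ in _) _ => He.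
have -> : r^-1 * I = 2 * (r^-1 / 2 * I) by field; rewrite gt_eqF.
lra.
Qed.

Lemma ball_subset_itv T r x : r < x -> x + r < T -> ball x r `<=` `]0, T[%classic.
Proof.
by move=> rx xT t; rewrite ball_itv /= !in_itv/= => /andP[? ?]; apply/andP; split; lra.
Qed.

Lemma bump_indic r x y t : 0 < r -> x <= y -> ~ ball x r t -> ~ ball y r t ->
  bump r x y t = \1_`]x, y[ t.
Proof.
move=> r0 xy; rewrite !ball_itv /= !in_itv/= => /negP + /negP.
rewrite !negb_and -!leNgt indicE /bump => tx ty.
have [txy|txy] := pselect (`]x, y[%classic t).
  rewrite mem_set//; move: txy; rewrite /= in_itv/= => /andP[xt ty'].
  case/orP: tx => ?; first by lra.
  case/orP: ty => ?; last by lra.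
  by rewrite (@ramp_right _ r (t - x)) ?(@ramp_left _ r (t - y)) ?subr0//; lra.
rewrite memNset//; move/negP: txy; rewrite /= in_itv/= negb_and -!leNgt => /orP[?|?].
  case/orP: tx => ?; last by lra.
  by rewrite !ramp_left ?subrr//; lra.
case/orP: ty => ?; first by lra.
by rewrite !ramp_right ?subrr//; lra.
Qed.

Lemma bump_bound r x y t : 0 < r -> `|bump r x y t| <= 1.
Proof.
move=> r0; have := ramp_bound (t - x) r0; have := ramp_bound (t - y) r0.
by move=> /andP[? ?] /andP[? ?]; rewrite /bump ler_norml; apply/andP; split; lra.
Qed.

Lemma measurable_bump r x y D : 0 < r -> measurable_fun D (bump r x y).
Proof.
move=> r0; apply: measurable_funTS; apply: continuous_measurable_fun => t.
apply: differentiable_continuous; apply/derivable1_diffP.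
by have [] := is_derive_bump x y t r0.
Qed.

Lemma indic01 (A : set R) t : 0 <= (\1_A t : R) <= 1.
Proof. by rewrite indicE; case: (_ \in _); rewrite lexx ler01. Qed.

(** Testing against a bump differs from integrating over ]x, y[ only on the two
    small balls where the bump climbs and descends. *)
Lemma bump_integral_error g T r x y : mu.-integrable setT (EFin \o g) ->
  0 < r -> r < x -> x < y -> y + r < T ->
  `|\int[mu]_(t in `]0, T[) (g t * bump r x y t) - \int[mu]_(t in `]x, y[) g t|
  <= 2 * \int[mu]_(t in ball x r `|` ball y r) `|g t|.
Proof.
move=> ig r0 rx xy yT.
have xT : x + r < T by lra.
have ry : r < y by lra.
have mD : measurable (`]0, T[%classic : set R) by [].
have iD : mu.-integrable `]0, T[ (EFin \o g) by apply: integrableS ig.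
have sub_xy : `]x, y[ `<=` `]0, T[.
  move=> t; rewrite /= !in_itv/= => /andP[xt ty].
  by rewrite (lt_trans _ xt) ?(lt_trans ty)//; clear -r0 rx yT; lra.
have mind : measurable_fun `]0, T[ (\1_`]x, y[ : R -> R).
  by apply: measurable_funTS; exact: measurable_indic.
have mb : measurable_fun `]0, T[ (bump r x y) by exact: measurable_bump.
have -> : \int[mu]_(t in `]0, T[) (g t * bump r x y t) - \int[mu]_(t in `]x, y[) g t
    = \int[mu]_(t in `]0, T[) (g t * (bump r x y t - \1_`]x, y[ t)).
  under [RHS]eq_Rintegral do rewrite mulrBr.
  rewrite RintegralB//; last 2 first.
  - apply: (integrable_funM_bounded (C := 1) (k := bump r x y)) => // t _.
    exact: bump_bound.
  - apply: (integrable_funM_bounded (C := 1) (k := \1_`]x, y[)) => // t _.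
    by have /andP[? ?] := indic01 `]x, y[ t; rewrite ger0_norm.
  congr (_ - _); rewrite (Rintegral_support sub_xy).
    by apply: eq_Rintegral => t txy; rewrite indicE txy mulr1.
  by move=> t txy; rewrite indicE memNset// mulr0.
set B := ball x r `|` ball y r.
have mB : measurable B by apply: measurableU; exact: measurable_ball.
have BD : B `<=` `]0, T[ by move=> t [/(ball_subset_itv rx xT)|/(ball_subset_itv ry yT)].
rewrite (Rintegral_support BD); last first.
  by move=> t /not_orP[? ?]; rewrite bump_indic ?(ltW xy)// subrr mulr0.
have igB : mu.-integrable B (EFin \o g) by apply: integrableS ig.
have ignB : mu.-integrable B (EFin \o (fun t => `|g t|)) by exact: integrable_norm.
have kB t : `|bump r x y t - \1_`]x, y[ t| <= 2.
  rewrite (le_trans (ler_normB _ _))// -[leRHS]/(1 + 1) lerD ?bump_bound//.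
  by have /andP[? ?] := indic01 `]x, y[ t; rewrite ger0_norm.
rewrite -RintegralZl//.
apply: Rintegral_le_bound => //.
- apply: (integrable_funM_bounded (C := 2) (k := fun t => bump r x y t - \1_`]x, y[ t)) => //.
  by apply: (measurable_funS mD BD); exact: measurable_funB.
- exact: integrable_funZ.
- by move=> t _; rewrite normrM mulrC ler_wpM2r.
Qed.

(** Test with [bump r x y] and let [r] tend to 0: the left-hand side of the weak
    formulation tends to [h x - h y] by [mollify], the right-hand side to
    [- \int_x^y g] by [bump_integral_error] and the absolute continuity of the
    integral of [g]. *)
Lemma lebesgue_pt_increment h g T x y :
  mu.-integrable setT (EFin \o h) -> mu.-integrable setT (EFin \o g) ->
  (forall phi, test_function T phi ->
    \int[mu]_(t in `]0, T[) (h t * derive1 phi t) =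
    - \int[mu]_(t in `]0, T[) (g t * phi t)) ->
  0 < x -> x < y -> y < T -> lebesgue_pt h x -> lebesgue_pt h y ->
  h y - h x = \int[mu]_(t in `]x, y[) g t.
Proof.
move=> ih ig H x0 xy yT hx hy.
apply/eqP; rewrite -subr_eq0 -normr_eq0 eq_le normr_ge0 andbT.
apply/ler_addgt0Pr => e e0; rewrite add0r.
have e40 : 0 < e / 4 by rewrite divr_gt0.
have [d1 d10 Hx] := mollify ih hx e40.
have [d2 d20 Hy] := mollify ih hy e40.
have [d3 [d30 Hg]] := integral_normr_continuous ig e40.
have [r [r0 rd1 rd2] [rd3 rx rT]] : exists2 r, [/\ 0 < r, r < d1 & r < d2] &
    [/\ r < d3 / 4, r < x & r < T - y].
  pose m := Num.min (Num.min (Num.min d1 d2) (d3 / 4)) (Num.min x (T - y)).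
  have m0 : 0 < m by rewrite !lt_min d10 d20 divr_gt0// x0 subr_gt0.
  have : m / 2 < m by rewrite ltr_pdivrMr// ltr_pMr// ltr1n.
  rewrite {2}/m !lt_min => /andP[/andP[/andP[? ?] ?] /andP[? ?]].
  by exists (m / 2); split => //; rewrite divr_gt0.
have yr : y + r < T by rewrite addrC -ltrBrDr.
have mD : measurable (`]0, T[%classic : set R) by [].
have ihD : mu.-integrable `]0, T[ (EFin \o h) by apply: integrableS ih.
have ihat a : mu.-integrable `]0, T[ (EFin \o (fun t => h t * hat r (t - a))).
  apply: (integrable_funM_bounded (C := r^-1)) => //; first exact: measurable_hat.
  by move=> t _; have /andP[? ?] := hat_bound (t - a) r0; rewrite ger0_norm.
have inball a : r < a -> a + r < T -> \int[mu]_(t in `]0, T[) (h t * hat r (t - a)) =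
    \int[mu]_(t in ball a r) (h t * hat r (t - a)).
  move=> ra aT; apply: Rintegral_support; first exact: ball_subset_itv.
  move=> t at_; rewrite hat_out ?mulr0// leNgt; apply/negP => tar; apply: at_.
  by rewrite /ball/= distrC.
have := H _ (@test_function_bump R T r x y r0 rx (ltW xy) yr).
rewrite derive1_bump//.
under eq_Rintegral do rewrite mulrBr.
have xr : x + r < T by rewrite (lt_trans _ yr)// ltrD2r.
rewrite RintegralB// !inball//; last exact: lt_trans rx xy.
have := bump_integral_error ig r0 rx xy yr.
have := Hx r r0 rd1; have := Hy r r0 rd2.
have : \int[mu]_(t in ball x r `|` ball y r) `|g t| < e / 4.
  apply: Hg; first by apply: measurableU; exact: measurable_ball.
  apply: (@le_lt_trans _ _ (mu (ball x r) + mu (ball y r))%E).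
    by apply: measureU2; exact: measurable_ball.
  rewrite !lebesgue_measure_ball ?(ltW r0)// -EFinD lte_fin -mulr_natr.
  by clear -rd3; lra.
set K := \int[mu]_(_ in _) `|_|.
set Ig := \int[mu]_(t in _) (g t * _); set I := \int[mu]_(t in _) g t.
set Ix := \int[mu]_(t in ball x r) _; set Iy := \int[mu]_(t in ball y r) _.
rewrite !ler_norml; clear.
by move=> ? /andP[? ?] /andP[? ?] /andP[? ?] ?; apply/andP; split; lra.
Qed.
End WeakDerivative.

(** * Primitives and continuous representatives *)

Section Primitive.
Context {R : realType}.
Notation mu := (@lebesgue_measure R).
Implicit Types (h g : R -> R) (x y t T : R).

(** Cutting [g] off outside ]0, T[ makes the primitive continuous on the whole
    half-line, although [g] is only integrable up to [T]. *)
Definition primitive T g x : R := \int[mu]_(t in `[0, x]) (g \_ `]0, T[) t.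

Lemma integrable_extend (D : set R) g : measurable D ->
  mu.-integrable D (EFin \o g) -> mu.-integrable setT (EFin \o (g \_ D)).
Proof.
move=> mD ig; rewrite -restrict_EFin.
by apply/(@integrable_mkcond _ _ _ mu D (EFin \o g) mD).
Qed.

Lemma primitive0 T g : primitive T g 0 = 0.
Proof. by rewrite /primitive set_itv1 Rintegral_set1. Qed.

Lemma primitive_increment T g x y : mu.-integrable `]0, T[ (EFin \o g) ->
  0 <= x -> x <= y ->
  primitive T g y - primitive T g x = \int[mu]_(t in `]x, y]) (g \_ `]0, T[) t.
Proof.
move=> ig x0 xy; apply: Rintegral_itvB; rewrite ?bnd_simp//.
by apply: integrableS (integrable_extend _ ig).
Qed.

Lemma primitive_uniformly_continuous T g : mu.-integrable `]0, T[ (EFin \o g) ->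
  forall e : R, 0 < e -> exists2 d : R, 0 < d & forall x y, 0 <= x -> x <= y ->
    y - x < d -> `|primitive T g y - primitive T g x| <= e.
Proof.
move=> ig e e0.
have ig0 : mu.-integrable setT (EFin \o (g \_ `]0, T[)) by exact: integrable_extend.
have [d [d0 Hd]] := integral_normr_continuous ig0 e0.
exists d => // x y x0 xy yxd.
rewrite primitive_increment//.
have ixy : mu.-integrable `]x, y] (EFin \o (g \_ `]0, T[)) by apply: integrableS ig0.
apply: (le_trans (@le_normr_Rintegral _ _ _ mu _ _ _ ixy)) => //.
have mxy : (mu `]x, y]%classic < d%:E)%E.
  by rewrite lebesgue_measure_itv/= lte_fin; case: ifP => _; rewrite -?EFinB lte_fin.
by apply: ltW; exact: Hd.
Qed.

Lemma primitive_increment_le T g x y : mu.-integrable `]0, T[ (EFin \o g) ->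
  0 <= x -> x <= y ->
  `|primitive T g y - primitive T g x| <= \int[mu]_(t in `]0, T[) `|g t|.
Proof.
move=> ig x0 xy.
have ig0 : mu.-integrable setT (EFin \o (g \_ `]0, T[)) by exact: integrable_extend.
rewrite primitive_increment//.
have ixy : mu.-integrable `]x, y] (EFin \o (g \_ `]0, T[)) by apply: integrableS ig0.
apply: (le_trans (@le_normr_Rintegral _ _ _ mu _ _ _ ixy)) => //.
have -> : \int[mu]_(t in `]0, T[) `|g t| = \int[mu]_(t in setT) `|(g \_ `]0, T[) t|.
  rewrite Rintegral_mkcond; apply: eq_Rintegral => t _.
  by rewrite !patchE; case: ifP => // _; rewrite normr0.
rewrite Rintegral_mkcond; apply: le_Rintegral => //.
- by apply: integrable_extend => //; exact: integrable_norm.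
- exact: integrable_norm.
- by move=> t _; rewrite [X in X <= _]patchE; case: ifP => _ /=; rewrite ?lexx ?normr_ge0.
Qed.

(** Almost all points are Lebesgue points; fix one of them and apply
    [lebesgue_pt_increment] to it and to any other. *)
Lemma weak_derivative_primitive h g T : 0 < T ->
  mu.-integrable `]0, T[ (EFin \o h) -> mu.-integrable `]0, T[ (EFin \o g) ->
  (forall phi, test_function T phi ->
    \int[mu]_(t in `]0, T[) (h t * derive1 phi t) =
    - \int[mu]_(t in `]0, T[) (g t * phi t)) ->
  exists k : R, {ae mu, forall x, 0 < x -> x < T -> h x = k + primitive T g x}.
Proof.
move=> T0 ih ig H.
pose h0 := h \_ `]0, T[; pose g0 := g \_ `]0, T[.
have ih0 : mu.-integrable setT (EFin \o h0) by exact: integrable_extend.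
have ig0 : mu.-integrable setT (EFin \o g0) by exact: integrable_extend.
have H0 phi : test_function T phi ->
    \int[mu]_(t in `]0, T[) (h0 t * derive1 phi t) =
    - \int[mu]_(t in `]0, T[) (g0 t * phi t).
  move=> /H E; rewrite -[LHS](_ : \int[mu]_(t in `]0, T[) (h t * derive1 phi t) = _).
    rewrite E; congr (- _); apply: eq_Rintegral => t tD.
    by rewrite /g0 patchE tD.
  by apply: eq_Rintegral => t tD; rewrite /h0 patchE tD.
have leb : {ae mu, forall x, lebesgue_pt h0 x}.
  by apply: lebesgue_differentiation; apply: open_integrable_locally => //; exact: openT.
have h0E x : 0 < x -> x < T -> h0 x = h x.
  by move=> x0 xT; rewrite /h0 patchE mem_set//= in_itv/= x0 xT.
have incr x y : 0 < x -> x < y -> y < T -> lebesgue_pt h0 x -> lebesgue_pt h0 y ->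
    h y - h x = primitive T g y - primitive T g x.
  move=> x0 xy yT hx hy.
  rewrite -!h0E ?(lt_trans xy)// ?(lt_trans x0)//.
  rewrite (lebesgue_pt_increment ih0 ig0 H0)// primitive_increment ?ltW//.
  rewrite Rintegral_itv_bndo_bndc//.
  by apply: integrableS ig0.
have [x1 /andP[x10 x1T] hx1] := ae_exists_between T0 leb.
exists (h x1 - primitive T g x1).
apply: ae_imply leb => x hx x0 xT.
have [xx1|x1x|->] := ltgtP x x1; last by rewrite subrK.
  by have := incr _ _ x0 xx1 x1T hx hx1; lra.
by have := incr _ _ x10 x1x xT hx1 hx; lra.
Qed.
End Primitive.

Section VectorPrimitive.
Context {R : realType} {n : nat}.
Notation E := ('rV[R]_n).
Notation mu := (@lebesgue_measure R).
Implicit Types (w g c : R -> E) (x y t T : R).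

Definition vprimitive T g x : E := \row_i primitive T (fun t => g t ord0 i) x.

Lemma ae_forall_ord m (P : 'I_m -> R -> Prop) :
  (forall i, {ae mu, forall t, P i t}) -> {ae mu, forall t, forall i, P i t}.
Proof.
move=> aeP.
have : {ae mu, forall t, forall k : nat, forall i : 'I_m, i = k :> nat -> P i t}.
  apply: ae_foralln => k.
  have [km|mk] := ltnP k m.
    apply: ae_imply (aeP (Ordinal km)) => t Pt i ik.
    by rewrite (_ : i = Ordinal km)//; exact: val_inj.
  by apply: aeW => t i ik; have := ltn_ord i; rewrite ik ltnNge mk.
by apply: ae_imply => t Pt i; exact: Pt.
Qed.

Lemma vprimitive_uniformly_continuous T g : L1 T g ->
  forall e : R, 0 < e -> exists2 d : R, 0 < d & forall x y, 0 <= x -> x <= y ->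
    y - x < d -> `|vprimitive T g y - vprimitive T g x| <= e.
Proof.
move=> ig e e0.
have /choice[d dP] (i : 'I_n) : exists d : R, 0 < d /\ forall x y, 0 <= x -> x <= y ->
    y - x < d -> `|vprimitive T g y ord0 i - vprimitive T g x ord0 i| <= e.
  have [d d0 H] := primitive_uniformly_continuous (ig i) e0.
  by exists d; split => // x y; rewrite !mxE; exact: H.
pose m := \big[Num.min/1]_i d i.
exists m.
  rewrite /m; elim/big_ind : _ => // [? ? ? ?|i _]; first by rewrite lt_min; apply/andP.
  by have [] := dP i.
move=> x y x0 xy yxm; apply: normr_mx_le => [|i]; first exact: ltW.
rewrite !mxE; have [_ Hi] := dP i; have := Hi x y x0 xy; rewrite !mxE; apply; apply: lt_le_trans yxm _.
exact: bigmin_le.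
Qed.

Lemma weak_derivative_vprimitive w g T : 0 < T -> L1 T w -> weak_derivative T w g ->
  exists k : E, {ae mu, forall x, 0 < x -> x < T -> w x = k + vprimitive T g x}.
Proof.
move=> T0 iw [ig H].
have [k kP] := choice (fun i => weak_derivative_primitive T0 (iw i) (ig i)
  (fun phi tphi => H phi tphi i)).
exists (\row_i k i).
apply: ae_imply (ae_forall_ord kP) => x wx x0 xT.
by apply/rowP => i; rewrite !mxE wx.
Qed.

Definition continuous_on_halfline c := forall x, 0 <= x -> forall e : R, 0 < e ->
  exists2 d : R, 0 < d & forall y, 0 <= y -> `|y - x| < d -> `|c y - c x| <= e.

Lemma continuous_on_halflineP c :
  {within `[0, +oo[, continuous c} <-> continuous_on_halfline c.
Proof.
split=> [/subspace_continuousP cc x x0 e e0|cc].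
  have : `[0, +oo[%classic x by rewrite /= in_itv/= x0.
  move=> /cc /cvgrPdist_le /(_ e e0)[d /= d0 H]; exists d => // y y0 yx.
  by rewrite distrC; apply: H; rewrite /= ?in_itv/= ?y0// distrC.
apply/subspace_continuousP => x; rewrite /= in_itv/= andbT => x0.
apply/cvgrPdist_le => e /(cc x x0)[d d0 H]; exists d => //= y yx.
by rewrite in_itv/= andbT => y0; rewrite distrC H// distrC.
Qed.

(** Near any point of [0, T], the ends included, there are points of ]0, T[ where
    the two functions agree. *)
Lemma continuous_on_halfline_eq c c' T : 0 < T ->
  continuous_on_halfline c -> continuous_on_halfline c' ->
  {ae mu, forall t, 0 < t -> t < T -> c t = c' t} ->
  forall x, 0 <= x -> x <= T -> c x = c' x.
Proof.
move=> T0 cc cc' aecc x x0 xT; apply/eqP; rewrite -subr_eq0 -normr_eq0.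
rewrite eq_le normr_ge0 andbT; apply/ler_addgt0Pr => e e0; rewrite add0r.
have e20 : 0 < e / 2 by rewrite divr_gt0.
have [d d0 Hd] := cc x x0 _ e20; have [d' d'0 Hd'] := cc' x x0 _ e20.
pose m := Num.min d d'; have m0 : 0 < m by rewrite lt_min d0.
have [t /andP[]] : exists2 t, Num.max 0 (x - m) < t < Num.min T (x + m) &
    0 < t -> t < T -> c t = c' t.
  apply: ae_exists_between => //; rewrite gt_max !lt_min T0/=; apply/and3P; split; lra.
rewrite gt_max lt_min => /andP[t0 xt] /andP[tT tx] /(_ t0 tT) ctE.
have : `|t - x| < m by rewrite ltr_distl xt tx.
rewrite lt_min => /andP[td td'].
have -> : c x - c' x = (c' t - c' x) - (c t - c x) by rewrite ctE opprB [RHS]addrC subrKA.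
rewrite (le_trans (ler_normB _ _))// (splitr e) lerD//.
  by apply: Hd' => //; exact: ltW.
by apply: Hd => //; exact: ltW.
Qed.

Lemma continuous_on_halfline_vprimitive k T g : L1 T g ->
  continuous_on_halfline (fun x => k + vprimitive T g x).
Proof.
move=> ig x x0 e /(vprimitive_uniformly_continuous ig)[d d0 H].
exists d => // y y0 yx; rewrite opprD addrACA subrr add0r.
have [xy|/ltW yx'] := leP x y.
  by apply: H => //; rewrite (le_lt_trans (ler_norm _)).
by rewrite distrC; apply: H => //; rewrite (le_lt_trans (ler_norm _))// distrC.
Qed.

Lemma continuous_rep_primitive w c g T : 0 < T -> L1 T w ->
  continuous_rep w c -> weak_derivative T w g ->
  forall x, 0 <= x -> x <= T -> c x = c 0 + vprimitive T g x.
Proof.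
move=> T0 iw [/continuous_on_halflineP cc wc] wg.
have [k wk] := weak_derivative_vprimitive T0 iw wg.
have ck : forall x, 0 <= x -> x <= T -> c x = k + vprimitive T g x.
  apply: continuous_on_halfline_eq => //.
    by apply: continuous_on_halfline_vprimitive; have [] := wg.
  by apply: ae_imply2 wk wc => t + + t0 tT => /(_ t0 tT) <- /(_ t0).
move=> x x0 xT; rewrite !ck// ?ltW//; congr (_ + _).
suff -> : vprimitive T g 0 = 0 by rewrite addr0.
by apply/rowP => i; rewrite !mxE primitive0.
Qed.

Lemma continuous_rep_unique w c c' : continuous_rep w c -> continuous_rep w c' ->
  forall x, 0 <= x -> c x = c' x.
Proof.
move=> [/continuous_on_halflineP cc wc] [/continuous_on_halflineP cc' wc'] x x0.
apply: (@continuous_on_halfline_eq c c' (x + 1)) => //.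
- by rewrite ltr_wpDl.
- by apply: ae_imply2 wc wc' => t + + t0 _ => /(_ t0) <- /(_ t0).
- by rewrite lerDl.
Qed.

(** The continuous functions provided on each ]0, T[ agree on overlaps.  Taking at
    [x] the value of the one for [T = x + 1] glues them: near [x] they all
    coincide with the one for [x + 2]. *)
Lemma continuous_rep_exists w : W11loc w -> exists c, continuous_rep w c.
Proof.
move=> W.
have loc (T : R) : exists c, 0 < T -> continuous_on_halfline c /\
    {ae mu, forall t, 0 < t -> t < T -> w t = c t}.
  have [T0|T0] := ltP 0 T; last by exists w.
  have [iw [g wg]] := W T T0.
  have [k wk] := weak_derivative_vprimitive T0 iw wg.
  exists (fun x => k + vprimitive T g x) => _; split => //.
  by apply: continuous_on_halfline_vprimitive; have [] := wg.
have [C CP] := choice loc.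
have C_eq S T x : 0 < S -> S <= T -> 0 <= x -> x <= S -> C S x = C T x.
  move=> S0 ST; have [cS wS] := CP _ S0; have [cT wT] := CP _ (lt_le_trans S0 ST).
  apply: continuous_on_halfline_eq => //.
  apply: ae_imply2 wS wT => t + + t0 tS => /(_ t0 tS) <- /(_ t0); apply.
  exact: lt_le_trans tS ST.
pose c x := C (x + 1) x.
have cE T x : 0 <= x -> x <= T -> 0 < T -> c x = C T x.
  move=> x0 xT T0; have x1 : 0 < x + 1 by rewrite ltr_wpDl.
  have [le|/ltW ge] := leP (x + 1) T; first by rewrite /c (C_eq (x + 1) T)// lerDl.
  by rewrite /c (C_eq T (x + 1)).
exists c; split.
  apply/continuous_on_halflineP => x x0 e e0.
  have x2 : 0 < x + 2 by rewrite ltr_wpDl.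
  have [cx _] := CP _ x2.
  have [d d0 H] := cx x x0 e e0.
  exists (Num.min d 1); first by rewrite lt_min d0 ltr01.
  move=> y y0; rewrite lt_min => /andP[yd y1].
  rewrite (cE (x + 2) y)// ?(cE (x + 2) x)//; first exact: H.
    by rewrite lerDl.
  by have := ler_norm (y - x); lra.
have : {ae mu, forall t, forall k : nat, 0 < t -> t < k.+1%:R -> w t = C k.+1%:R t}.
  by apply: ae_foralln => k; have [] := CP k.+1%:R (ltr0Sn _ _).
apply: ae_imply => t + t0.
move=> /(_ (Num.truncn t) t0 (truncnS_gt _)) ->.
by rewrite (cE (Num.truncn t).+1%:R)// ?ltW// truncnS_gt.
Qed.
End VectorPrimitive.

(** * Weak derivatives: linearity, uniqueness, bounds *)

Section Sobolev11.
Context {R : realType} {n : nat}.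
Notation E := ('rV[R]_n).
Notation mu := (@lebesgue_measure R).
Implicit Types (w g c : R -> E) (x y t T : R).

Lemma test_function_outside T phi t : test_function T phi -> ~ `]0, T[%classic t ->
  phi t = 0 /\ derive1 phi t = 0.
Proof.
move=> [_ _ [a [b [a0 bT out]]]] tD.
have tout : t < a \/ b < t.
  have [tb|] := leP t b; last by right.
  left; rewrite ltNge; apply/negP => ta; apply: tD.
  by rewrite /= in_itv/= (lt_le_trans a0 ta) (le_lt_trans tb bT).
have phi0 s : s < a \/ b < s -> phi s = 0.
  by move=> sout; apply: out; rewrite in_itv/= negb_and -!ltNge; apply/orP.
split; first exact: phi0.
rewrite derive1E (near_eq_derive (g := cst 0)) ?derive_cst//.
case: tout => tout.
  by near=> s; apply: phi0; left; near: s; exact: lt_nbhsl.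
by near=> s; apply: phi0; right; near: s; exact: lt_nbhsr.
Unshelve. all: by end_near. Qed.

Lemma test_function_continuous T phi : test_function T phi -> continuous phi.
Proof.
by move=> [dphi _ _] t; apply: differentiable_continuous; exact/derivable1_diffP.
Qed.

Lemma continuous_support_bounded (a b : R) (phi : R -> R) : continuous phi ->
  (forall t, t \notin `[a, b] -> phi t = 0) -> exists C, forall t, `|phi t| <= C.
Proof.
move=> cphi out; have [ab|ba] := leP a b; last first.
  exists 0 => t; rewrite out ?normr0// in_itv/= negb_and -!ltNge.
  by have [?|?] := ltP t a => //=; apply: lt_le_trans ba _.
have cn : {within `[a, b], continuous (fun t => `|phi t|)}.
  apply: continuous_subspaceT => t; apply: (continuous_comp (cphi t)).
  exact: norm_continuous.
have [c cab cmax] := EVT_max ab cn.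
exists `|phi c| => t; have [/cmax//|/out ->] := boolP (t \in `[a, b]).
by rewrite normr0.
Qed.

Lemma test_function_bounded T phi : test_function T phi ->
  exists C, forall t, `|phi t| <= C /\ `|derive1 phi t| <= C.
Proof.
move=> tphi; have cphi := test_function_continuous tphi.
have [_ cdphi _] := tphi.
have out t : t \notin `[0, T] -> ~ `]0, T[%classic t.
  by apply: contraNnot; rewrite /= !in_itv/= => /andP[? ?]; rewrite !ltW.
have [C1 H1] : exists C, forall t, `|phi t| <= C.
  apply: (@continuous_support_bounded 0 T) => // t /out tD.
  by have [] := test_function_outside tphi tD.
have [C2 H2] : exists C, forall t, `|derive1 phi t| <= C.
  apply: (@continuous_support_bounded 0 T) => // t /out tD.
  by have [] := test_function_outside tphi tD.
by exists (Num.max C1 C2) => t; rewrite !le_max H1 H2 orbT.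
Qed.

Lemma test_functionS S T phi : S <= T -> test_function S phi -> test_function T phi.
Proof.
move=> ST [d c [a [b [a0 bS out]]]]; split=> //.
by exists a, b; split=> //; exact: lt_le_trans bS ST.
Qed.

Lemma subset_itv0 S T : S <= T -> `]0, S[ `<=` `]0, T[%classic.
Proof.
move=> ST t; rewrite /= !in_itv/= => /andP[-> tS] /=; exact: lt_le_trans tS ST.
Qed.

Lemma L1S S T w : S <= T -> L1 T w -> L1 S w.
Proof.
move=> ST iw i; apply: (integrableS _ _ _ (iw i)) => //.
exact: subset_itv0.
Qed.

Lemma L1_comb T (a : R) w1 w2 : L1 T w1 -> L1 T w2 -> L1 T (a *: w1 + w2).
Proof.
move=> i1 i2 i.
rewrite (_ : (fun _ => _) = EFin \o (fun t => a * w1 t ord0 i + w2 t ord0 i)); last first.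
  by apply/funext => t; rewrite /= !mxE.
apply: integrable_funD => //; last exact: i2.
by apply: integrable_funZ => //; exact: i1.
Qed.

Lemma weak_derivativeS S T w g : S <= T ->
  weak_derivative T w g -> weak_derivative S w g.
Proof.
move=> ST [ig H]; split=> [|phi tphi i]; first exact: L1S ig.
have := H phi (test_functionS ST tphi) i.
rewrite !(Rintegral_support (subset_itv0 ST))// => t tS.
  by rewrite (test_function_outside tphi tS).1 mulr0.
by rewrite (test_function_outside tphi tS).2 mulr0.
Qed.

Lemma integrableM_test T phi w i : L1 T w -> test_function T phi ->
  mu.-integrable `]0, T[ (EFin \o (fun t => w t ord0 i * phi t)) /\
  mu.-integrable `]0, T[ (EFin \o (fun t => w t ord0 i * derive1 phi t)).
Proof.
move=> iw tphi; have [C HC] := test_function_bounded tphi.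
have cphi := test_function_continuous tphi; have [_ cdphi _] := tphi.
split.
  apply: (integrable_funM_bounded (C := C) (k := phi)) => //; first exact: iw.
    by apply: measurable_funTS; exact: continuous_measurable_fun.
  by move=> t _; have [] := HC t.
apply: (integrable_funM_bounded (C := C) (k := derive1 phi)) => //; first exact: iw.
  by apply: measurable_funTS; exact: continuous_measurable_fun.
by move=> t _; have [] := HC t.
Qed.

Lemma weak_derivative_comb T (a : R) w1 w2 g1 g2 : L1 T w1 -> L1 T w2 ->
  weak_derivative T w1 g1 -> weak_derivative T w2 g2 ->
  weak_derivative T (a *: w1 + w2) (a *: g1 + g2).
Proof.
move=> i1 i2 [ig1 H1] [ig2 H2]; split; first exact: L1_comb.
move=> phi tphi i.
have comb (h1 h2 psi : R -> R) :
    mu.-integrable `]0, T[ (EFin \o (fun t => h1 t * psi t)) ->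
    mu.-integrable `]0, T[ (EFin \o (fun t => h2 t * psi t)) ->
    \int[mu]_(t in `]0, T[) ((a * h1 t + h2 t) * psi t) =
    a * \int[mu]_(t in `]0, T[) (h1 t * psi t) + \int[mu]_(t in `]0, T[) (h2 t * psi t).
  move=> ih1 ih2; rewrite -RintegralZl// -RintegralD//; last exact: integrable_funZ.
  by apply: eq_Rintegral => t _; rewrite mulrDl mulrA.
have [iw1 iw1'] := integrableM_test i i1 tphi.
have [iw2 iw2'] := integrableM_test i i2 tphi.
have [jg1 _] := integrableM_test i ig1 tphi.
have [jg2 _] := integrableM_test i ig2 tphi.
have := comb _ _ _ iw1' iw2'; have := comb _ _ _ jg1 jg2.
rewrite H1// H2// => E1 E2.
transitivity (\int[mu]_(t in `]0, T[) ((a * w1 t ord0 i + w2 t ord0 i) * derive1 phi t)).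
  by apply: eq_Rintegral => t _; rewrite !mxE.
rewrite E2 mulrN -opprD -E1; congr (- _).
by apply: eq_Rintegral => t _; rewrite !mxE.
Qed.

(** For [T <= 0] the interval is empty and every function is a weak derivative. *)
Lemma W11_exists_weak_derivative w T : W11loc w ->
  L1 T w /\ exists g, weak_derivative T w g.
Proof.
move=> W; have [T0|T0] := ltP 0 T; first exact: W.
have D0 : `]0, T[%classic = set0 :> set R by rewrite set_itv_ge// bnd_simp -leNgt.
have L0 z : L1 T z by move=> i; rewrite D0; exact: integrable_set0.
split=> //; exists (fun=> 0); split=> // phi tphi i.
by rewrite D0 !Rintegral_set0 oppr0.
Qed.

Lemma W11loc_comb (a : R) w1 w2 : W11loc w1 -> W11loc w2 -> W11loc (a *: w1 + w2).
Proof.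
move=> W1 W2 T T0; have [i1 [g1 wg1]] := W1 T T0; have [i2 [g2 wg2]] := W2 T T0.
split; first exact: L1_comb.
by exists (a *: g1 + g2); exact: weak_derivative_comb.
Qed.

Lemma continuous_rep_comb (a : R) w1 w2 c1 c2 :
  continuous_rep w1 c1 -> continuous_rep w2 c2 ->
  continuous_rep (a *: w1 + w2) (a *: c1 + c2).
Proof.
move=> [k1 e1] [k2 e2]; split; last first.
  by apply: ae_imply2 e1 e2 => t E1 E2 t0; rewrite !fctE E1// E2.
move=> x; apply: continuousD; last exact: k2.
by apply: continuousZl_tmp; exact: k1.
Qed.

(** By the Lebesgue differentiation theorem a primitive has derivative [g] almost
    everywhere. *)
Lemma primitive_injective T (g1 g2 : R -> R) :
  mu.-integrable `]0, T[ (EFin \o g1) -> mu.-integrable `]0, T[ (EFin \o g2) ->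
  (forall x, 0 <= x -> x <= T -> primitive T g1 x = primitive T g2 x) ->
  {ae mu, forall t, 0 < t -> t < T -> g1 t = g2 t}.
Proof.
have ftc (g : R -> R) : mu.-integrable `]0, T[ (EFin \o g) ->
    {ae mu, forall t, 0 < t -> derive1 (primitive T g) t = (g \_ `]0, T[) t}.
  move=> ig; have ig0 := integrable_extend (measurable_itv _) ig.
  have locg : locally_integrable setT (g \_ `]0, T[).
    by apply: open_integrable_locally => //; exact: openT.
  have igy y : mu.-integrable `[0, y] (EFin \o (g \_ `]0, T[)) by apply: integrableS ig0.
  apply: ae_imply (@FTC1 _ _ (BLeft 0) igy locg) => t + t0.
  by move=> H; have [] := H; first by rewrite lte_fin.
move=> /ftc d1 /ftc d2 prim12; apply: ae_imply2 d1 d2 => t + + t0 tT.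
have tD : t \in `]0, T[%classic by rewrite inE /= in_itv/= t0.
move=> /(_ t0) + /(_ t0); rewrite !patchE tD.
rewrite !derive1E => <- <-; apply: near_eq_derive.
near=> x; apply: prim12; apply: ltW.
  by near: x; exact: lt_nbhsr.
by near: x; exact: lt_nbhsl.
Unshelve. all: by end_near. Qed.

Lemma weak_derivative_unique w g1 g2 T : L1 T w ->
  weak_derivative T w g1 -> weak_derivative T w g2 ->
  {ae mu, forall t, 0 < t -> t < T -> g1 t = g2 t}.
Proof.
move=> iw wg1 wg2; have [T0|T0] := ltP 0 T; last first.
  by apply: aeW => t t0 tT; have := lt_le_trans (lt_trans t0 tT) T0; rewrite ltxx.
have [k1 H1] := weak_derivative_vprimitive T0 iw wg1.
have [k2 H2] := weak_derivative_vprimitive T0 iw wg2.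
have [[ig1 _] [ig2 _]] := (wg1, wg2).
have kE : forall x, 0 <= x -> x <= T -> k1 + vprimitive T g1 x = k2 + vprimitive T g2 x.
  apply: continuous_on_halfline_eq => //; try exact: continuous_on_halfline_vprimitive.
  by apply: ae_imply2 H1 H2 => t + + t0 tT => /(_ t0 tT) <- /(_ t0 tT) <-.
have kk : k1 = k2.
  have := kE 0 (lexx _) (ltW T0).
  have z g : vprimitive T g 0 = 0 by apply/rowP => i; rewrite !mxE primitive0.
  by rewrite !z !addr0.
have : {ae mu, forall t, forall i, 0 < t -> t < T -> g1 t ord0 i = g2 t ord0 i}.
  apply: ae_forall_ord => i; apply: primitive_injective => [||x x0 xT]; [exact: ig1|exact: ig2|].
  have := kE x x0 xT; rewrite kk => /addrI /rowP/(_ i).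
  by rewrite !mxE.
by apply: ae_imply => t H t0 tT; apply/rowP => i; exact: H.
Qed.

Lemma measurable_normr_mx (D : set R) w : measurable_on D w ->
  measurable_fun D (fun t => `|w t|).
Proof.
move=> mw.
rewrite (_ : (fun _ => _) = (fun t =>
    \big[Num.max/0]_(k : 'I_1 * 'I_n) `|w t k.1 k.2|)); last first.
  by apply/funext => t; exact: mx_normrE.
rewrite unlock; elim: (index_enum _) => [|k s IH] /=; first exact: measurable_cst.
apply: measurable_maxr => //; apply: measurableT_comp; first exact: normr_measurable.
by rewrite (ord1 k.1); exact: mw.
Qed.

Lemma L1_measurable T w : L1 T w -> measurable_on `]0, T[ w.
Proof. by move=> iw i; have /integrableP[/measurable_EFinP] := iw i. Qed.

Lemma L1_norm T w : L1 T w -> mu.-integrable `]0, T[ (EFin \o (fun t => `|w t|)).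
Proof.
move=> iw.
have isum : mu.-integrable `]0, T[ (EFin \o (fun t => \sum_(i < n) `|w t ord0 i|)).
  rewrite (_ : _ \o _ = fun t => (\sum_(i < n) `|w t ord0 i|%:E)%E).
    apply: integrable_sum => // i _.
    exact: (@integrable_norm _ _ _ mu _ (fun t => w t ord0 i) (iw i)).
  by apply/funext => t; rewrite /= sumEFin.
apply: le_integrable isum => //.
  by apply/measurable_EFinP; apply: measurable_normr_mx; exact: L1_measurable.
move=> t _; rewrite /= lee_fin normr_id ger0_norm ?sumr_ge0//.
apply: normr_mx_le => [|i]; first exact: sumr_ge0.
by rewrite (bigD1 i)//= lerDl sumr_ge0.
Qed.

(** The oscillation of [c] on [0, T] is at most the integral of [|g|], and
    [|c|] does not exceed the mean of [|w|] everywhere. *)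
Lemma continuous_rep_bound w c g T : 0 < T -> L1 T w ->
  continuous_rep w c -> weak_derivative T w g -> forall x, 0 <= x -> x <= T ->
  `|c x| <= T^-1 * (\int[mu]_(t in `]0, T[) `|w t|) + \int[mu]_(t in `]0, T[) `|g t|.
Proof.
move=> T0 iw cw wg x x0 xT; have [ig _] := wg.
have ing := L1_norm ig; have inw := L1_norm iw.
set Iw := \int[mu]_(t in _) `|w t|; set Ig := \int[mu]_(t in _) `|g t|.
have Iw0 : 0 <= Iw by exact: Rintegral_ge0.
have Ig0 : 0 <= Ig by exact: Rintegral_ge0.
have osc_le s t : 0 <= s -> s <= t -> t <= T -> `|c t - c s| <= Ig.
  move=> s0 st tT.
  have cE := continuous_rep_primitive T0 iw cw wg.
  rewrite (cE t (le_trans s0 st) tT) (cE s s0 (le_trans st tT)).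
  rewrite opprD addrACA subrr add0r; apply: normr_mx_le => // i.
  rewrite !mxE (le_trans (primitive_increment_le (ig i) s0 st))//.
  apply: le_Rintegral => //; first exact: (@integrable_norm _ _ _ mu _ (fun t => g t ord0 i) (ig i)).
  by move=> u _; exact: normr_coord_le.
have osc t : 0 <= t -> t <= T -> `|c x| - Ig <= `|c t|.
  move=> t0 tT; rewrite lerBlDl -lerBlDr (le_trans (lerB_dist _ _))//.
  by have [?|/ltW ?] := leP x t; [rewrite distrC|]; exact: osc_le.
have [m0|m0] := leP (`|c x| - Ig) 0.
  by rewrite (@le_trans _ _ Ig) ?lerDr ?mulr_ge0 ?invr_ge0 ?(ltW T0)// -subr_le0.
rewrite -lerBlDr ler_pdivlMl// mulrC.
have -> : (`|c x| - Ig) * T = \int[mu]_(t in `]0, T[) (cst (`|c x| - Ig)) t.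
  have mT : fine (mu `]0, T[%classic) = T.
    by rewrite lebesgue_measure_itv/= lte_fin T0/= subr0.
  by rewrite Rintegral_cst//; congr (_ * _); exact/esym.
rewrite /Iw /Rintegral fine_le//.
- by apply: integrable_fin_num => //; apply: (integrable_bounded (C := `|c x| - Ig)) => //;
    [exact: itv_finite|move=> t _; rewrite gtr0_norm].
- exact: integrable_fin_num.
apply: ae_ge0_le_integral => //.
- by move=> t _; rewrite lee_fin ltW.
- by apply/measurable_EFinP; exact: measurable_cst.
- by apply/measurable_EFinP; apply: measurable_normr_mx; exact: L1_measurable.
have [_] := cw; apply: ae_imply => t wc.
by rewrite /= in_itv/= => /andP[t0 tT]; rewrite lee_fin wc// osc// ltW.
Qed.
End Sobolev11.

(** * The spectral representation as a functional *)

Section Duality.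
Context {R : realType} {n : nat}.
Notation E := ('rV[R]_n).
Notation mu := (@lebesgue_measure R).
Implicit Types (w g c u : R -> E) (x y t T : R).

Lemma integrable_ae_eq (D : set R) (h k : R -> R) : measurable D ->
  measurable_fun D h -> mu.-integrable D (EFin \o k) ->
  {ae mu, forall t, D t -> h t = k t} ->
  mu.-integrable D (EFin \o h) /\ \int[mu]_(t in D) h t = \int[mu]_(t in D) k t.
Proof.
move=> mD mh ik hk; have /integrableP[mk koo] := ik.
have mhE : measurable_fun D (EFin \o h) by exact/measurable_EFinP.
split; last first.
  rewrite /Rintegral; congr fine; apply: ae_eq_integral => //.
  by apply: ae_imply hk => t H Dt; rewrite /= H.
apply/integrableP; split => //.
have -> : (\int[mu]_(t in D) `|(EFin \o h) t| = \int[mu]_(t in D) `|(EFin \o k) t|)%E.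
  apply: ae_eq_integral => //; try exact: measurableT_comp.
  by apply: ae_imply hk => t H Dt; rewrite /= H.
exact: koo.
Qed.

Lemma Rintegral_sum (D : set R) m (F : 'I_m -> R -> R) : measurable D ->
  (forall i, mu.-integrable D (EFin \o F i)) ->
  mu.-integrable D (EFin \o (fun t => \sum_(i < m) F i t)) /\
  \int[mu]_(t in D) (\sum_(i < m) F i t) = \sum_(i < m) \int[mu]_(t in D) F i t.
Proof.
move=> mD iF.
have H : forall s : seq 'I_m, mu.-integrable D (EFin \o (fun t => \sum_(i <- s) F i t)) /\
    \int[mu]_(t in D) (\sum_(i <- s) F i t) = \sum_(i <- s) \int[mu]_(t in D) F i t.
  elim=> [|i s [is_ IH]].
    under eq_Rintegral do rewrite big_nil.
    rewrite big_nil (_ : _ \o _ = cst 0%E); last by apply/funext => t; rewrite /= big_nil.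
    by split; [exact: integrable0|rewrite Rintegral_cst// mul0r].
  under eq_Rintegral do rewrite big_cons.
  rewrite big_cons (_ : _ \o _ = EFin \o (fun t => F i t + \sum_(j <- s) F j t)); last first.
    by apply/funext => t; rewrite /= big_cons.
  by split; [exact: integrable_funD|rewrite RintegralD// IH].
exact: H.
Qed.

(** The bound on [u] only holds almost everywhere; clamping the coordinates of [u]
    to [-M, M] gives an equivalent function bounded everywhere. *)
Lemma dot_integrable T g u M : 0 <= M -> L1 T g -> measurable_on `]0, T[ u ->
  {ae mu, forall t, 0 < t -> t < T -> `|u t| <= M} ->
  mu.-integrable `]0, T[ (EFin \o (fun t => dot (g t) (u t))) /\
  `|\int[mu]_(t in `]0, T[) dot (g t) (u t)|
    <= n%:R * M * \int[mu]_(t in `]0, T[) `|g t|.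
Proof.
move=> M0 ig um uM.
pose clamp (r : R) := Num.max (- M) (Num.min M r).
have clampM r : `|clamp r| <= M.
  rewrite ler_norml /clamp le_max lexx/= ge_max ge_min lexx/= andbT; lra.
have clampE r : `|r| <= M -> clamp r = r.
  by rewrite ler_norml => /andP[? ?]; rewrite /clamp min_r// max_r.
have mclamp i : measurable_fun `]0, T[ (fun t => clamp (u t ord0 i)).
  by apply: measurable_maxr => //; apply: measurable_minr => //; exact: um.
pose u' t : E := \row_i clamp (u t ord0 i).
have u'M t : `|u' t| <= M by apply: normr_mx_le => // i; rewrite mxE.
have ii i : mu.-integrable `]0, T[ (EFin \o (fun t => g t ord0 i * clamp (u t ord0 i))).
  by apply: (integrable_funM_bounded (C := M) (k := fun t => clamp (u t ord0 i))) => //;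
    exact: ig.
have [id' _] := Rintegral_sum (measurable_itv _) ii.
have [id dE] : mu.-integrable `]0, T[ (EFin \o (fun t => dot (g t) (u t))) /\
    \int[mu]_(t in `]0, T[) dot (g t) (u t) = \int[mu]_(t in `]0, T[) dot (g t) (u' t).
  apply: integrable_ae_eq => //.
  - apply: measurable_sum => i; apply: measurable_funM; last exact: um.
    exact: L1_measurable.
  - rewrite (_ : _ \o _ = EFin \o (fun t => \sum_(i < n) g t ord0 i * clamp (u t ord0 i)))//.
    by apply/funext => t; rewrite /dot /=; congr EFin; apply: eq_bigr => i _; rewrite mxE.
  - apply: ae_imply uM => t uM; rewrite /= in_itv/= => /andP[t0 tT].
    apply: eq_bigr => i _; rewrite mxE clampE// (le_trans (normr_coord_le _ _))//.
    exact: uM.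
split => //; rewrite dE.
have id1 : mu.-integrable `]0, T[ (EFin \o (fun t => dot (g t) (u' t))).
  rewrite (_ : _ \o _ = EFin \o (fun t => \sum_(i < n) g t ord0 i * clamp (u t ord0 i)))//.
  by apply/funext => t; rewrite /dot /=; congr EFin; apply: eq_bigr => i _; rewrite mxE.
have ing := L1_norm ig.
rewrite -RintegralZl//; apply: Rintegral_le_bound => //; first exact: integrable_funZ.
move=> t _; rewrite (le_trans (normr_dot_le _ _))// -mulrA ler_wpM2l// mulrC.
by rewrite ler_wpM2r.
Qed.

Lemma measurable_u_IS (v : R -> E) : measurable_on `]0, +oo[%classic v ->
  measurable_on `]0, +oo[%classic (u_IS v).
Proof.
move=> v_meas i.
have minv : measurable_fun (`]0, +oo[%classic : set R) (fun t : R => t^-1).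
  apply: open_continuous_measurable_fun => [|t]; [exact: rray_open|].
  by rewrite inE /= in_itv/= andbT => t0; apply: inv_continuous; rewrite gt_eqF.
have sub : (fun t : R => t^-1) @` `]0, +oo[ `<=` (`]0, +oo[%classic : set R).
  by move=> _ [t + <-]; rewrite /= !in_itv/= !andbT invr_gt0.
exact: measurable_comp (measurable_itv _) sub (v_meas i) minv.
Qed.

Variables (J : E -> R) (f : E) (v : R -> E) (M : R).
Hypotheses (M_ge0 : 0 <= M) (v_meas : measurable_on `]0, +oo[%classic v)
  (u_le : {ae mu, forall t, 0 < t -> `|u_IS v t| <= M}).
Let P : E := orth_proj (nullspace J) f.

Lemma dot_u_IS_integrable T g : L1 T g ->
  mu.-integrable `]0, T[ (EFin \o (fun t => dot (g t) (u_IS v t))) /\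
  `|\int[mu]_(t in `]0, T[) dot (g t) (u_IS v t)|
    <= n%:R * M * \int[mu]_(t in `]0, T[) `|g t|.
Proof.
move=> ig; apply: dot_integrable => //.
  move=> i; apply: measurable_funS (measurable_u_IS v_meas i) => //.
  by move=> t; rewrite /= !in_itv/= andbT => /andP[].
by apply: ae_imply u_le => t ut t0 _; exact: ut.
Qed.

Lemma phi_IS_formula_eq T w c1 c2 g1 g2 : 0 <= T -> W11loc w ->
  continuous_rep w c1 -> continuous_rep w c2 ->
  weak_derivative T w g1 -> weak_derivative T w g2 ->
  phi_IS_formula J f v T c1 g1 = phi_IS_formula J f v T c2 g2.
Proof.
move=> T0 W r1 r2 d1 d2; rewrite /phi_IS_formula.
have cE := continuous_rep_unique r1 r2.
rewrite (cE 0)// (cE T)//; congr (_ + _).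
have [iw _] := W11_exists_weak_derivative T W.
have [[/dot_u_IS_integrable[i1 _] _] [/dot_u_IS_integrable[i2 _] _]] := (d1, d2).
apply: (integrable_ae_eq _ _ i2 _).2 => //.
  by have /integrableP[/measurable_EFinP] := i1.
apply: ae_imply (weak_derivative_unique iw d1 d2) => t gE.
by rewrite /= in_itv/= => /andP[? ?]; rewrite gE.
Qed.

Lemma crepP w : W11loc w -> continuous_rep w (crep w).
Proof. by move=> /continuous_rep_exists[c cw]; apply: (xgetPex (fun=> 0)); exists c. Qed.

Lemma wderivP T w : W11loc w -> weak_derivative T w (wderiv T w).
Proof.
move=> /(@W11_exists_weak_derivative _ _ _ T)[_ [g wg]].
by apply: (xgetPex (fun=> 0)); exists g.
Qed.

Lemma phi_ISE T w c g : 0 <= T -> W11loc w ->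
  continuous_rep w c -> weak_derivative T w g ->
  phi_IS J f v T w = phi_IS_formula J f v T c g.
Proof.
move=> T0 W cw wg.
exact: phi_IS_formula_eq T0 W (crepP W) cw (wderivP T W) wg.
Qed.

(** On ]S, T[ the function [u_IS] is the projection [P], so the additional integral
    is [\int_S^T g.P = (c(T) - c(S)).P], which cancels the change of the boundary
    term. *)
Lemma phi_IS_extinction_le S T w : extinction_time J f v S -> S <= T -> W11loc w ->
  phi_IS J f v T w = phi_IS J f v S w.
Proof.
move=> [S0 uP]; rewrite le_eqVlt => /predU1P[->//|ST] W.
have T0 := le_lt_trans S0 ST.
have cw := crepP W; have wg := wderivP T W.
have wgS := weak_derivativeS (ltW ST) wg.
rewrite (phi_ISE (ltW T0) W cw wg) (phi_ISE S0 W cw wgS) /phi_IS_formula -/P.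
set c := crep w in cw *; set g := wderiv T w in wg wgS *.
have [ig _] := wg; have [iw _] := W11_exists_weak_derivative T W.
have [idot _] := dot_u_IS_integrable ig.
have sST : `]S, T[ `<=` `]0, T[%classic.
  by move=> t; rewrite /= !in_itv/= => /andP[/(le_lt_trans S0) -> ->].
have igST i : mu.-integrable `]S, T[ (EFin \o (fun t => g t ord0 i)).
  by apply: integrableS (ig i) => //; exact: sST.
have iP i : mu.-integrable `]S, T[ (EFin \o (fun t => g t ord0 i * P ord0 i)).
  have := integrable_funZ (P ord0 i) (measurable_itv _) (igST i).
  by apply: eq_integrable => // t _; rewrite /= mulrC.
have [idP dP] := Rintegral_sum (measurable_itv _) iP.
have incr : dot (c T) P - dot (c S) P = \int[mu]_(t in `]S, T[) dot (g t) P.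
  have cE := continuous_rep_primitive T0 iw cw wg.
  rewrite -dotBl (cE T (ltW T0) (lexx _)) (cE S S0 (ltW ST)) opprD addrACA subrr add0r.
  rewrite dP; apply: eq_bigr => i _.
  rewrite RintegralZr//; congr (_ * _).
  rewrite !mxE primitive_increment//; [|exact: ig|exact: ltW].
  rewrite -Rintegral_itv_bndo_bndc; last first.
    have ig0 := integrable_extend (g := fun t => g t ord0 i) (measurable_itv _) (ig i).
    by apply: integrableS ig0.
  apply: eq_Rintegral => t; rewrite inE /= in_itv/= => /andP[St tT].
  by rewrite patchE mem_set//= in_itv/= tT (le_lt_trans S0 St).
have split : \int[mu]_(t in `]0, T[) dot (g t) (u_IS v t) -
    \int[mu]_(t in `]0, S[) dot (g t) (u_IS v t) = \int[mu]_(t in `]S, T[) dot (g t) P.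
  have idotS : mu.-integrable `]S, T[ (EFin \o (fun t => dot (g t) (u_IS v t))).
    by apply: integrableS idot => //; exact: sST.
  rewrite (@Rintegral_itv_bndo_bndc _ (BRight 0) S); last first.
    by apply: integrableS idot => //; exact: (subset_itv0 (ltW ST)).
  rewrite Rintegral_itvB ?bnd_simp//.
  rewrite /Rintegral; congr fine; apply: ae_eq_integral => //.
  - by have /integrableP[] := idotS.
  - by have /integrableP[] := idP.
  by apply: ae_imply uP => t ut; rewrite /= in_itv/= => /andP[St tT]; rewrite ut// ltW.
by move: split incr; clear; lra.
Qed.

Lemma phi_IS_extinction_indep S T w : extinction_time J f v S ->
  extinction_time J f v T -> W11loc w -> phi_IS J f v S w = phi_IS J f v T w.
Proof.
move=> eS eT W; have [ST|/ltW TS] := leP S T.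
  by rewrite (phi_IS_extinction_le eS ST W).
by rewrite (phi_IS_extinction_le eT TS W).
Qed.

Lemma phi_IS_is_well_defined T : extinction_time J f v T ->
  phi_IS_well_defined J f v T.
Proof.
move=> eT w W; have [T0 _] := eT; split.
- exact: continuous_rep_exists.
- by have [] := W11_exists_weak_derivative T W.
- move=> c g cw wg; split; last exact: phi_ISE.
  by have [/dot_u_IS_integrable[]] := wg.
- by move=> T' eT'; exact: phi_IS_extinction_indep.
Qed.

Lemma phi_IS_linear T : 0 <= T -> W11loc_linear (phi_IS J f v T).
Proof.
move=> T0 a w1 w2 W1 W2.
have [c1 c2] := (crepP W1, crepP W2).
have [d1 d2] := (wderivP T W1, wderivP T W2).
have [i1 _] := W11_exists_weak_derivative T W1.
have [i2 _] := W11_exists_weak_derivative T W2.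
rewrite (phi_ISE T0 (W11loc_comb a W1 W2) (continuous_rep_comb a c1 c2)
  (weak_derivative_comb a i1 i2 d1 d2)).
rewrite /phi_IS /phi_IS_formula.
have [[/dot_u_IS_integrable[j1 _] _] [/dot_u_IS_integrable[j2 _] _]] := (d1, d2).
have -> : \int[mu]_(t in `]0, T[) dot ((a *: wderiv T w1 + wderiv T w2) t) (u_IS v t) =
    a * \int[mu]_(t in `]0, T[) dot (wderiv T w1 t) (u_IS v t) +
    \int[mu]_(t in `]0, T[) dot (wderiv T w2 t) (u_IS v t).
  rewrite -RintegralZl// -RintegralD//; last exact: integrable_funZ.
  by apply: eq_Rintegral => t _; rewrite dotDl dotZl.
have dE (x : R) (y : E) : dot ((a *: crep w1 + crep w2) x) y =
    a * dot (crep w1 x) y + dot (crep w2 x) y.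
  by rewrite -dotZl -dotDl.
rewrite (dE 0) (dE T).
set I1 := \int[mu]_(_ in _) _; set I2 := \int[mu]_(_ in _) _.
set A1 := dot (crep w1 0) f; set A2 := dot (crep w2 0) f.
set B1 := dot (crep w1 T) _; set B2 := dot (crep w2 T) _.
by clear; ring.
Qed.

(** The length [T + 1] instead of [T] keeps the interval non-empty for [T = 0] and,
    being at least 1, bounds the mean of [|w|] by its integral. *)
Lemma phi_IS_le_seminorm T w : 0 <= T -> W11loc w ->
  `|phi_IS J f v T w| <= (n%:R * `|f| + n%:R * `|P| + n%:R * M) * W11_seminorm (T + 1) w.
Proof.
move=> T0 W; have T1 : 0 < T + 1 by rewrite ltr_wpDl.
have TT1 : T <= T + 1 by rewrite lerDl.
have cw := crepP W; have wg := wderivP (T + 1) W.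
have [iw _] := W (T + 1) T1; have [ig _] := wg.
rewrite (phi_ISE T0 W cw (weak_derivativeS TT1 wg)) /phi_IS_formula -/P.
have := continuous_rep_bound T1 iw cw wg.
rewrite /W11_seminorm; set c := crep w; set g := wderiv (T + 1) w.
set Iw := \int[mu]_(t in _) `|w t|; set Ig := \int[mu]_(t in _) `|g t| => cle.
have Iw0 : 0 <= Iw by exact: Rintegral_ge0.
have cb x : 0 <= x -> x <= T + 1 -> `|c x| <= Iw + Ig.
  move=> x0 xT; rewrite (le_trans (cle x x0 xT))// lerD2r ler_piMl//.
  by rewrite invf_le1// lerDr.
have [_ dle] := dot_u_IS_integrable (L1S TT1 ig).
have gle : \int[mu]_(t in `]0, T[) `|g t| <= Ig.
  have ing := L1_norm ig; have ingT := L1_norm (L1S TT1 ig).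
  rewrite /Ig /Rintegral fine_le//; try exact: integrable_fin_num.
  apply: ge0_subset_integral => //; last exact: subset_itv0.
  by have /integrableP[] := ing.
have d0 := normr_dot_le (c 0) f; have dT := normr_dot_le (c T) P.
rewrite (le_trans (ler_normD _ _))// !mulrDl lerD//.
  rewrite (le_trans (ler_normB _ _))// lerD// -mulrA.
    by rewrite (le_trans d0)// ler_wpM2l// mulrC ler_wpM2l// cb// ltW.
  by rewrite (le_trans dT)// ler_wpM2l// mulrC ler_wpM2l// cb.
rewrite (le_trans dle)// ler_wpM2l ?mulr_ge0// (le_trans gle)//.
by rewrite lerDr.
Qed.

Lemma phi_IS_continuous T : 0 <= T -> W11loc_continuous (phi_IS J f v T).
Proof.
move=> T0 w0 W0 A /nbhs_ballP[e /= e0 eA].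
pose C := n%:R * `|f| + n%:R * `|P| + n%:R * M.
have C0 : 0 <= C by rewrite !addr_ge0// mulr_ge0.
exists (T + 1, e / (C + 1)) => /=.
  by split; [rewrite ltr_wpDl|rewrite divr_gt0// ltr_wpDl].
move=> w [W ww0]; apply: eA; rewrite /ball/= distrC.
have W' : W11loc (w - w0).
  by rewrite -scaleN1r addrC; exact: W11loc_comb.
have -> : phi_IS J f v T w - phi_IS J f v T w0 = phi_IS J f v T (w - w0).
  by rewrite -(scaleN1r w0) (addrC w) phi_IS_linear// mulN1r addrC.
rewrite (le_lt_trans (phi_IS_le_seminorm T0 W'))// -/C.
have [s0|s0] := leP (W11_seminorm (T + 1) (w - w0)) 0.
  by rewrite (le_lt_trans _ e0)// mulr_ge0_le0.
apply: (@le_lt_trans _ _ ((C + 1) * W11_seminorm (T + 1) (w - w0))).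
  by rewrite ler_wpM2r ?(ltW s0)// lerDl.
by rewrite -ltr_pdivlMl ?(ltr_wpDl C0)// mulrC.
Qed.
End Duality.

Theorem proposition6 (R : realType) (n : nat)
    (J : 'rV[R]_n -> R) (f : 'rV[R]_n) (q v : R -> 'rV[R]_n)
    (J_ge0 : forall x, 0 <= J x)
    (J_convex : convex_function setT J)
    (J_lsc : lower_semicontinuous (fun x => (J x)%:E))
    (J_hom : abs_homogeneous1 J)
    (flow : inverse_scale_space_flow J f q v) :
  [/\ exists M : R,
        {ae @lebesgue_measure R, forall t : R, 0 < t -> `|u_IS v t| <= M},
      forall t0 : R, 0 < t0 -> [lipschitz p_IS q t | t in `[t0, +oo[],
      exists T : R, extinction_time J f v T &
      forall T : R, extinction_time J f v T ->
        [/\ phi_IS_well_defined J f v T,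
            W11loc_linear (phi_IS J f v T) &
            W11loc_continuous (phi_IS J f v T)]].
Proof.
have u_le := u_IS_bounded J_hom flow.
have M_ge0 : 0 <= n%:R * `|f| by rewrite mulr_ge0.
have [_ v_meas _ _ _] := flow.
split.
- by exists (n%:R * `|f|); exact: u_le.
- by move=> t0 t00; apply: (p_IS_lipschitz J_hom flow).
- exact: (extinction_time_exists J_ge0 J_hom J_convex flow).
- move=> T T_ext; have [T_ge0 _] := T_ext; split.
  + exact: phi_IS_is_well_defined M_ge0 v_meas u_le _ T_ext.
  + exact: phi_IS_linear M_ge0 v_meas u_le _ T_ge0.
  + exact: phi_IS_continuous M_ge0 v_meas u_le _ T_ge0.
Qed.
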